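(* Let $(\mathbb{B},\|\cdot\|)$ be a separable $\beta$-smooth Banach space and let $(X_n)_{n\ge1}$ be $\mathbb{B}$-valued random variables adapted to a filtration $(\mathcal{F}_n)_{n\ge0}$ such that $\mathbb{E}(X_n\mid\mathcal{F}_{n-1})=\mu$ for all $n\ge1$ (some unknown $\mu\in\mathbb{B}$) and $\sup_{n\ge1}\mathbb{E}(\|X_n\|^p\mid\mathcal{F}_{n-1})\le v<\infty$ for known $p\in(1,2]$ and $v>0$. For $\lambda>0$ let $\widehat{\mu}_n(0,\lambda,0):=\frac1n\sum_{m\le n}\mathtt{Trunc}(\lambda X_m)X_m$. Fix $\delta\in(0,1]$. Then for any $\lambda>0$, with probability at least $1-\delta$, simultaneously for all $n\ge1$, \[ \|\widehat{\mu}_n(0,\lambda,0)-\mu\|\le2v\lambda^{p-1}\big(\beta\mathfrak{C}_p(\mathbb{B})+K_p2^{p-1}\big)+\frac{\beta\log(2/\delta)}{\lambda n}. \] Moreover, for a fixed sample size $n$, if \[ \lambda=\left(\frac{\log(2/\delta)\beta}{2nv(\beta\mathfrak{C}_p(\mathbb{B})+K_p2^{p-1})}\right)^{1/p}, \] then with probability at least $1-\delta$, \[ \|\widehat{\mu}_n(0,\lambda,0)-\mu\|\le2\big(2v(\beta\mathfrak{C}_p(\mathbb{B})+K_p2^{p-1})\big)^{1/p}\left(\beta\frac{\log(2/\delta)}{n}\right)^{(p-1)/p}. \]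
   Context: $\beta$-smooth: the norm $f=\|\cdot\|$ satisfies $f(0)=0$, $|f(x+y)-f(x)|\le\|y\|$ and $f^2(x+y)+f^2(x-y)\le2f^2(x)+2\beta^2\|y\|^2$ for all $x,y$. $\mathtt{Trunc}(x):=\min\{1,1/\|x\|\}$ ($\mathtt{Trunc}(0)=1$). $K_p:=\frac1p\left(\frac{p-1}{p}\right)^{p-1}$. $\mathfrak{C}_p(\mathbb{B}):=2^{p-1}\frac{e^{2/\beta}-2/\beta-1}{(2/\beta)^2}$ if $\mathbb{B}$ is a Hilbert space and $\mathfrak{C}_p(\mathbb{B}):=2^{p+1}\frac{e^{2/\beta}-2/\beta-1}{(2/\beta)^2}$ otherwise. *)

(* Defs.v *)
From HB Require Import structures.
From mathcomp Require Import all_boot all_order all_algebra.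
From mathcomp Require Import all_classical all_reals all_analysis.
Set Implicit Arguments. Unset Strict Implicit. Unset Printing Implicit Defensive.
Import Order.TTheory GRing.Theory Num.Theory.
Import numFieldNormedType.Exports.
Local Open Scope classical_set_scope.
Local Open Scope ring_scope.

Definition separable {R : realType} (B : normedModType R) : Prop :=
  exists D : set B, countable D /\ closure D = setT.

Definition beta_smooth {R : realType} (B : normedModType R) (beta : R) : Prop :=
  (forall x y : B, `| `|x + y| - `|x| | <= `|y|) /\
  (forall x y : B, `|x + y| ^+ 2 + `|x - y| ^+ 2 <= 2 * `|x| ^+ 2 + 2 * beta ^+ 2 * `|y| ^+ 2).

Definition is_hilbert {R : realType} (B : normedModType R) : Prop :=
  exists ip : B -> B -> R,
    (forall a x y z, ip (a *: x + y) z = a * ip x z + ip y z) /\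
    (forall x y, ip x y = ip y x) /\
    (forall x, `|x| ^+ 2 = ip x x).

Definition cont_lin_functional {R : realType} (B : normedModType R) (phi : B -> R) : Prop :=
  (forall (a : R) (x y : B), phi (a *: x + y) = a * phi x + phi y) /\ continuous phi.

Definition Trunc {R : realType} {B : normedModType R} (x : B) : R :=
  if x == 0 then 1 else Num.min 1 (`|x|^-1).

Definition Kp {R : realType} (p : R) : R := p^-1 * ((p - 1) / p) `^ (p - 1).

Definition Cp {R : realType} (B : normedModType R) (beta p : R) : R :=
  (if `[< is_hilbert B >] then 2 `^ (p - 1) else 2 `^ (p + 1)) *
  ((expR (2 / beta) - 2 / beta - 1) / (2 / beta) ^+ 2).

Definition filtration {d} {T : measurableType d} (F : nat -> set (set T)) : Prop :=
  (forall n, sigma_algebra setT (F n)) /\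
  (forall n, F n `<=` measurable) /\
  (forall n m, (n <= m)%N -> F n `<=` F m).

(* X_n is F_n-measurable for the Borel sigma-algebra of B (n >= 1) *)
Definition adapted {d} {T : measurableType d} {R : realType} {B : normedModType R}
  (F : nat -> set (set T)) (X : nat -> T -> B) : Prop :=
  forall n, (1 <= n)%N -> forall U : set B, open U -> F n (X n @^-1` U).

Definition mu_hat {T : Type} {R : realType} {B : normedModType R}
  (X : nat -> T -> B) (lam : R) (n : nat) (w : T) : B :=
  (n%:R)^-1 *: \sum_(1 <= m < n.+1) (Trunc (lam *: X m w) *: X m w).

(* Main.v *)
Require Import Defs.
From HB Require Import structures.
From mathcomp Require Import all_boot all_order all_algebra.
From mathcomp Require Import all_classical all_reals all_analysis.
From mathcomp Require Import measurable_realfun ring lra.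
Import Order.TTheory GRing.Theory Num.Theory.
Import numFieldNormedType.Exports.
Set Implicit Arguments. Unset Strict Implicit. Unset Printing Implicit Defensive.
Local Open Scope classical_set_scope.
Local Open Scope ring_scope.

(** Let [a := lam / beta] and let [S_n] be [a] times the sum of the centred
    truncations [Trunc (lam X_m) X_m - mu].  Smoothness makes the norm
    differentiable away from [0] with derivative [l_s] at [s], and gives, for
    [`|y| <= M],
      [cosh |s+y| <= cosh |s| + sinh |s| l_s(y) + beta^2 |y|^2 phi(M) cosh |s|]
    with [phi(x) = (e^x - x - 1) / x^2].  Applied at [s0 = s - a mu] with
    [y = a Trunc (lam X) X], together with the convexity of [cosh |.|], this
    bounds [cosh |s + a (Trunc (lam X) X - mu)|] by [cosh |s|], plus a continuous
    linear functional of [X - mu], plus a multiple of [|X|^p cosh |s|].  The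
    functional integrates to zero, so no vector-valued integral is needed, and
    [cosh |S_n| / (1 + rho)^n] is a supermartingale: [S_{n-1}] is replaced by a
    countably valued approximation.  Ville's maximal inequality concludes.
    The argument needs [lam |mu| <= 5/8] (so that [e^{lam |mu|} <= 2]); for
    larger means the bound already exceeds [1 / lam + |mu|] because
    [|mu|^p <= v].  The Hilbert value of the constant [Cp] is the smaller one,
    and it suffices in every smooth space. *)

(** * Exponential inequalities *)

Definition coshR {R : realType} (x : R) : R := (expR x + expR (- x)) / 2.
Definition sinhR {R : realType} (x : R) : R := (expR x - expR (- x)) / 2.
(** The remainder factor of [Cp], which takes it at [2 / beta]. At [0] division by zero gives the
    value [0] instead of the limit 1/2, so the lemmas about it ask for a positive argument. *)
Definition exp_rem {R : realType} (x : R) : R := (expR x - x - 1) / x ^+ 2.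

Section exponential_inequalities.
Variable R : realType.
Implicit Types x y c r w a M : R.

(** For [x >= 0] the partial sums of the exponential series increase to their limit. *)
Lemma expR_ge_Taylor4 x : 0 <= x ->
  1 + x + x ^+ 2 / 2 + x ^+ 3 / 6 + x ^+ 4 / 24 <= expR x.
Proof.
move=> x0; rewrite /expR.
have -> : 1 + x + x ^+ 2 / 2 + x ^+ 3 / 6 + x ^+ 4 / 24 =
    series (exp_coeff x) 5%N.
  rewrite /series /= !big_nat_recl//= big_nil /exp_coeff /= /factorial /=.
  by rewrite expr0 !divr1 expr1 addr0 !addrA.
apply: nondecreasing_cvgn_le; last exact: is_cvg_series_exp_coeff.
apply/nondecreasing_seqP => n; rewrite /series /= big_nat_recr//= lerDl.
exact: exp_coeff_ge0.
Qed.

Lemma expR_ge_quad x : 0 <= x -> 1 + x + x ^+ 2 / 2 <= expR x.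
Proof.
move=> x0; have := expR_ge_Taylor4 x0.
have := exprn_ge0 3 x0; have := exprn_ge0 4 x0; lra.
Qed.

Lemma exp_rem_ge_half x : 0 < x -> 2^-1 <= exp_rem x.
Proof.
move=> x0; rewrite /exp_rem ler_pdivlMr ?exprn_gt0//.
have := expR_ge_quad (ltW x0); lra.
Qed.

(** With the fourth-order Taylor bound the claim becomes [x^2 - 8 x + 12 = (x - 2) (x - 6) >= 0],
    whence the range up to [2]. At [2 / beta] it yields [1 <= beta * exp_rem (2 / beta)]. *)
Lemma exp_rem_ge_id2 x : 0 < x <= 2 -> x / 2 <= exp_rem x.
Proof.
move=> /andP[x0 x2]; rewrite /exp_rem ler_pdivlMr ?exprn_gt0//.
have := expR_ge_Taylor4 (ltW x0).
have : 0 <= x ^+ 2 * ((x - 2) * (x - 6)).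
  by rewrite mulr_ge0 ?sqr_ge0// mulr_le0//; lra.
lra.
Qed.

(** After cross-multiplication the series of [e^y - y - 1] compare term by term:
    [x^(i+2) M^2 <= M^(i+2) x^2]. *)
Lemma exp_rem_le x M : 0 < x <= M -> exp_rem x <= exp_rem M.
Proof.
move=> /andP[x0 xM]; have M0 := lt_le_trans x0 xM.
rewrite /exp_rem ler_pdivrMr ?exprn_gt0// mulrAC ler_pdivlMr ?exprn_gt0//.
pose u y := fun n => series (exp_coeff y) n - y - 1.
have cu y : u y n @[n --> \oo] --> expR y - y - 1.
  apply: cvgB; last exact: cvg_cst.
  apply: cvgB; last exact: cvg_cst.
  exact: is_cvg_series_exp_coeff.
have c1 : u x n * M ^+ 2 @[n --> \oo] --> (expR x - x - 1) * M ^+ 2.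
  by apply: cvgM; [exact: cu|exact: cvg_cst].
have c2 : u M n * x ^+ 2 @[n --> \oo] --> (expR M - M - 1) * x ^+ 2.
  by apply: cvgM; [exact: cu|exact: cvg_cst].
apply: (ler_cvg_to c1 c2); exists 2%N => //= -[|[|n]]// _.
have uE y : u y n.+2 = \sum_(0 <= i < n) exp_coeff y i.+2.
  rewrite /u /series /= big_nat_recl//= big_nat_recl//= /exp_coeff /=.
  rewrite /factorial /= expr0 !divr1 expr1; lra.
rewrite !uE !mulr_suml; apply: ler_sum => i _; rewrite /exp_coeff /=.
rewrite mulrAC [leRHS]mulrAC ler_wpM2r ?invr_ge0//.
rewrite 2!exprS [M ^+ i.+2]exprS [M ^+ i.+1]exprS.
have := @lerXn2r _ i x M; rewrite !nnegrE => /(_ (ltW x0) (ltW M0) xM) H.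
have := mulr_ge0 (mulr_ge0 (ltW x0) (ltW M0)) (mulr_ge0 (ltW x0) (ltW M0)).
nra.
Qed.

Lemma coshR_gt0 x : 0 < coshR x.
Proof. by rewrite /coshR divr_gt0// addr_gt0// expR_gt0. Qed.

Lemma coshR_continuous : continuous (@coshR R).
Proof.
move=> x; apply: cvgM; last exact: cvg_cst.
apply: cvgD; first exact: continuous_expR.
apply: (@continuous_comp _ _ _ -%R (@expR R)); first exact: opp_continuous.
exact: continuous_expR.
Qed.

Lemma coshR0 : coshR 0 = 1 :> R.
Proof. by rewrite /coshR oppr0 expR0; lra. Qed.

Lemma coshR_ge1 x : 1 <= coshR x.
Proof. rewrite /coshR; have := expR_ge1Dx x; have := expR_ge1Dx (- x); lra. Qed.

Lemma sinhR0 : sinhR 0 = 0 :> R.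
Proof. by rewrite /sinhR oppr0 subrr mul0r. Qed.

Lemma sinhR_ge0 x : 0 <= x -> 0 <= sinhR x.
Proof. by move=> x0; rewrite /sinhR divr_ge0// subr_ge0 ler_expR; lra. Qed.

Lemma sinhR_le_coshR x : sinhR x <= coshR x.
Proof. rewrite /sinhR /coshR; have := expR_ge0 (- x); lra. Qed.

Lemma expR_le_2coshR x : expR x <= 2 * coshR x.
Proof. rewrite /coshR; have := expR_ge0 (- x); lra. Qed.

Lemma coshR_tangent c x : coshR c + sinhR c * (x - c) <= coshR x.
Proof.
have H1 : expR c * (1 + (x - c)) <= expR x.
  rewrite -[X in _ <= expR X](_ : c + (x - c) = x); last ring.
  by rewrite expRD ler_wpM2l ?expR_ge0 ?expR_ge1Dx.
have H2 : expR (- c) * (1 + (c - x)) <= expR (- x).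
  rewrite -[X in _ <= expR X](_ : - c + (c - x) = - x); last ring.
  by rewrite expRD ler_wpM2l ?expR_ge0 ?expR_ge1Dx.
rewrite /coshR /sinhR; lra.
Qed.

Lemma coshR_le x y : 0 <= x <= y -> coshR x <= coshR y.
Proof.
move=> /andP[x0 xy]; apply: le_trans (coshR_tangent x y).
by rewrite lerDl mulr_ge0 ?sinhR_ge0// subr_ge0.
Qed.

Lemma coshR_le_expR x e y : 0 <= x -> x <= y + e -> 0 <= e ->
  coshR x <= expR e * coshR y.
Proof.
move=> x0 xye e0; have /le_trans -> // : coshR x <= coshR (y + e).
  by apply: coshR_le; rewrite x0.
have : expR (- e) <= expR e by rewrite ler_expR; lra.
rewrite /coshR opprD !expRD => H.
have := ler_wpM2l (expR_ge0 (- y)) H; lra.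
Qed.

Lemma sinhR_mean c : 0 < c -> exists2 x, 0 <= x <= c & sinhR c = c * coshR x.
Proof.
move=> c0.
have dsinh x : is_derive x 1 (@sinhR R) (coshR x).
  rewrite /sinhR; apply: is_derive_eq.
  rewrite /GRing.scale /= /coshR; lra.
have [|x /itvP xc] := @MVT R (@sinhR R) (@coshR R) 0 c c0.
  apply: derivable_within_continuous => x _; exact: ex_derive.
by rewrite sinhR0 !subr0 mulrC => ->; exists x; rewrite ?xc.
Qed.

Lemma sinhR_bounds c : 0 <= c -> c <= sinhR c <= c * coshR c.
Proof.
rewrite le_eqVlt => /predU1P[<-|c0]; first by rewrite sinhR0 mul0r lexx.
have [x x0c ->] := sinhR_mean c0.
by rewrite ler_peMr ?coshR_ge1 ?(ltW c0)// ler_wpM2l ?coshR_le// ltW.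
Qed.

(** By the addition formula the error beyond first order is [cosh c (cosh x - 1) + sinh c (sinh x -
    x)]. Since [0 <= sinh c <= cosh c], it is at most [cosh c (e^|x| - 1 - |x|)]: for [x < 0] the
    second term is nonpositive and [|x| <= sinh |x|] handles the first. *)
Lemma coshRD_le c x M : 0 <= c -> `|x| <= M -> 0 < M ->
  coshR (c + x) <= coshR c + sinhR c * x + coshR c * x ^+ 2 * exp_rem M.
Proof.
move=> c0 xM M0.
have rem : expR `|x| - 1 - `|x| <= x ^+ 2 * exp_rem M.
  have [->|x0] := eqVneq x 0; first by rewrite normr0 expR0; lra.
  have := @exp_rem_le `|x| M; rewrite normr_gt0 x0 xM => /(_ isT) H.
  have := ler_wpM2l (sqr_ge0 x) H; apply: le_trans.
  rewrite /exp_rem real_normK ?num_real// mulrC mulfVK ?expf_neq0//; lra.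
apply: (@le_trans _ _ (coshR c + sinhR c * x + coshR c * (expR `|x| - 1 - `|x|))); last first.
  by rewrite -mulrA lerD2l ler_wpM2l// ltW// coshR_gt0.
rewrite /coshR /sinhR opprD !expRD.
have E1 := expR_gt0 c; have E2 := expR_gt0 (- c).
have E12 : expR (- c) <= expR c by rewrite ler_expR; lra.
have sx : 0 <= expR `|x| - expR (- `|x|) - 2 * `|x|.
  have /andP[+ _] := sinhR_bounds (normr_ge0 x); rewrite /sinhR; lra.
have [x0|x0] := leP 0 x.
  rewrite ger0_norm// in sx *; nra.
rewrite ltr0_norm// opprK in sx *; nra.
Qed.

End exponential_inequalities.

Lemma coshR_norm_continuous {R : realType} {B : normedModType R} :
  continuous (fun x : B => coshR `|x|).
Proof.
move=> x; apply: (@continuous_comp _ _ _ (fun z : B => `|z|) (@coshR R)).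
  exact: norm_continuous.
exact: coshR_continuous.
Qed.

(** * The derivative of a smooth norm *)

Lemma ler_addeps_mul {R : realType} (a b K : R) :
  (forall e, 0 < e -> a <= b + e * K) -> a <= b.
Proof.
move=> H; have K1 : 0 < `|K| + 1 by rewrite ltr_wpDl.
apply/ler_addgt0Pr => e e0.
apply: le_trans (H (e / (`|K| + 1)) _) _; first by rewrite divr_gt0.
rewrite lerD2l mulrAC ler_pdivrMr// ler_pM2l//.
by rewrite (le_trans (ler_norm _))// lerDl.
Qed.

Section norm_derivative.
Variables (R : realType) (B : normedModType R) (beta : R).
Hypothesis smooth : beta_smooth B beta.
Implicit Types (s x y z : B) (t u e M : R).

Lemma beta_smooth_sqr x y :
  `|x + y| ^+ 2 + `|x - y| ^+ 2 <= 2 * `|x| ^+ 2 + 2 * beta ^+ 2 * `|y| ^+ 2.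
Proof. by case: smooth. Qed.

(** Smoothness at the base point [0] reads [|x|^2 <= beta^2 |x|^2]. The case [beta < 1] of the
    theorem is thus that of the zero space. *)
Lemma beta_smooth_lt1_norm0 : 0 < beta < 1 -> forall x, `|x| = 0.
Proof.
move=> /andP[b0 b1] x; have := beta_smooth_sqr 0 x.
rewrite add0r sub0r normrN normr0 expr0n mulr0 add0r => H.
apply/eqP; rewrite -sqrf_eq0 eq_le sqr_ge0 andbT.
have : beta ^+ 2 < 1 by rewrite expr_lt1// ltW.
have := sqr_ge0 `|x|; nra.
Qed.

Definition norm_quot s y t : R := (`|s + t *: y| - `|s|) / t.

(** The right directional derivative of the norm. Quotients increase with [t] by convexity, so the
    infimum is the limit at [0+], and it makes sense even at [s = 0], where it is the norm
    itself. *)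
Definition norm_deriv s y : R := inf [set norm_quot s y t | t in [set t | 0 < t]].

Lemma norm_quot_bound s y t : 0 < t -> `|norm_quot s y t| <= `|y|.
Proof.
move=> t0; rewrite /norm_quot normrM normfV (gtr0_norm t0) ler_pdivrMr//.
rewrite (le_trans (ler_dist_dist _ _))// addrAC subrr add0r normrZ gtr0_norm//.
by rewrite mulrC.
Qed.

Lemma norm_quot_le s y t u : 0 < t <= u -> norm_quot s y t <= norm_quot s y u.
Proof.
move=> /andP[t0 tu]; have u0 := lt_le_trans t0 tu.
rewrite /norm_quot ler_pdivrMr// mulrAC ler_pdivlMr//.
have -> : s + t *: y = (1 - t / u) *: s + (t / u) *: (s + u *: y).
  rewrite scalerDr scalerBl scale1r scalerA divfK ?gt_eqF//.
  by rewrite addrA subrK.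
have : `|(1 - t / u) *: s + (t / u) *: (s + u *: y)| <=
    (1 - t / u) * `|s| + (t / u) * `|s + u *: y|.
  have a0 : 0 <= 1 - t / u by rewrite subr_ge0 ler_pdivrMr// mul1r.
  have b0 : 0 <= t / u by rewrite divr_ge0// ltW.
  by rewrite (le_trans (ler_normD _ _))// 2!normrZ (ger0_norm a0) (ger0_norm b0).
move/(ler_wpM2r (ltW u0)).
rewrite (_ : ((1 - t / u) * `|s| + t / u * `|s + u *: y|) * u =
  (u - t) * `|s| + t * `|s + u *: y|); last by field; rewrite gt_eqF.
lra.
Qed.

Lemma norm_deriv_has_inf s y :
  has_inf [set norm_quot s y t | t in [set t | 0 < t]].
Proof.
split; first by exists (norm_quot s y 1); exists 1 => //=.
exists (- `|y|) => _ [t /= t0 <-].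
by have := norm_quot_bound s y t0; rewrite ler_norml => /andP[].
Qed.

Lemma norm_deriv_le_quot s y t : 0 < t -> norm_deriv s y <= norm_quot s y t.
Proof.
move=> t0; apply: ge_inf; first by case: (norm_deriv_has_inf s y).
by exists t.
Qed.

Lemma le_norm_deriv s y a :
  (forall t, 0 < t -> a <= norm_quot s y t) -> a <= norm_deriv s y.
Proof.
move=> H; apply: lb_le_inf; first by case: (norm_deriv_has_inf s y).
by move=> _ [t /= t0 <-]; exact: H.
Qed.

Lemma norm_deriv_adherent s y e : 0 < e ->
  exists2 t0, 0 < t0 & forall t, 0 < t <= t0 -> norm_quot s y t < norm_deriv s y + e.
Proof.
move=> e0; have [_ [t /= t0 <-] H] := inf_adherent e0 (norm_deriv_has_inf s y).
by exists t => // u ut; apply: le_lt_trans H; exact: norm_quot_le.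
Qed.

Lemma norm_deriv_bound s y : `|norm_deriv s y| <= `|y|.
Proof.
rewrite ler_norml; apply/andP; split.
  apply: le_norm_deriv => t t0.
  by have := norm_quot_bound s y t0; rewrite ler_norml => /andP[].
apply: le_trans (norm_deriv_le_quot s y ltr01) _.
by have := norm_quot_bound s y ltr01; rewrite ler_norml => /andP[].
Qed.

Lemma norm_deriv_subgradient s y : norm_deriv s y <= `|s + y| - `|s|.
Proof.
by have := norm_deriv_le_quot s y ltr01; rewrite /norm_quot scale1r divr1.
Qed.

Lemma norm_deriv_subadd s y z :
  norm_deriv s (y + z) <= norm_deriv s y + norm_deriv s z.
Proof.
apply: (@ler_addeps_mul _ _ _ 2) => e e0.
have [t1 t10 H1] := norm_deriv_adherent s y e0.
have [t2 t20 H2] := norm_deriv_adherent s z e0.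
pose t := Num.min t1 t2.
have t0 : 0 < t by rewrite lt_min t10.
have {}H1 := H1 t; have {}H2 := H2 t.
rewrite t0 ge_min lexx /= in H1; rewrite t0 ge_min lexx orbT /= in H2.
have th : 0 < t / 2 by rewrite divr_gt0.
apply: le_trans (norm_deriv_le_quot s (y + z) th) _.
suff : norm_quot s (y + z) (t / 2) <= norm_quot s y t + norm_quot s z t.
  have := H1 isT; have := H2 isT; lra.
rewrite /norm_quot -mulrDl ler_pdivrMr// mulrAC ler_pdivlMr//.
(* Half a step along [y + z] is the midpoint of full steps along [y] and [z]. *)
have E : s + (t / 2) *: (y + z) = 2^-1 *: ((s + t *: y) + (s + t *: z)).
  rewrite !scalerDr !scalerA [RHS]addrACA -[X in _ = X + _]scalerDl.
  rewrite (_ : 2^-1 + 2^-1 = 1 :> R); last lra.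
  by rewrite scale1r [2^-1 * t]mulrC.
have : `|s + (t / 2) *: (y + z)| <= 2^-1 * (`|s + t *: y| + `|s + t *: z|).
  by rewrite E normrZ ger0_norm// ler_wpM2l// ler_normD.
nra.
Qed.

Lemma norm_derivZ_ge0 s y t : 0 <= t -> norm_deriv s (t *: y) = t * norm_deriv s y.
Proof.
have d0 : norm_deriv s 0 = 0.
  apply/eqP; rewrite -normr_le0.
  by apply: le_trans (norm_deriv_bound s 0) _; rewrite normr0.
rewrite le_eqVlt => /predU1P[<-|t0]; first by rewrite scale0r mul0r.
have H y' u : 0 < u -> u * norm_deriv s y' <= norm_deriv s (u *: y').
  move=> u0; apply: le_norm_deriv => r r0.
  rewrite -ler_pdivlMl//.
  apply: le_trans (norm_deriv_le_quot s y' (mulr_gt0 r0 u0)) _.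
  by rewrite /norm_quot scalerA invfM mulrA [leRHS]mulrC.
apply/eqP; rewrite eq_le H// andbT.
have := H (t *: y) t^-1; rewrite invr_gt0 scalerA mulVf ?gt_eqF// scale1r.
by move=> /(_ t0); rewrite ler_pdivrMl.
Qed.

Lemma norm_deriv_self s : norm_deriv s s = `|s|.
Proof.
apply/eqP; rewrite eq_le; apply/andP; split.
  by apply: le_trans (norm_deriv_bound s s); exact: ler_norm.
apply: le_norm_deriv => t t0; rewrite /norm_quot ler_pdivlMr//.
have -> : s + t *: s = (1 + t) *: s by rewrite scalerDl scale1r.
rewrite normrZ ger0_norm ?addr_ge0 ?(ltW t0)//; lra.
Qed.

(** Smoothness bounds the second difference [|s + t y| + |s - t y| - 2 |s|] by
    [beta^2 t^2 |y|^2 / |s|], which is negligible against [t]; hence the left and right derivatives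
    agree. *)
Lemma norm_derivN s y : s != 0 -> norm_deriv s (- y) = - norm_deriv s y.
Proof.
move=> s0.
apply/eqP; rewrite eq_le; apply/andP; split; last first.
  have := norm_deriv_subadd s y (- y); rewrite subrr.
  by rewrite -(scale0r 0) norm_derivZ_ge0// mul0r; lra.
have c0 : 0 < `|s| by rewrite normr_gt0.
rewrite -subr_le0 opprK.
apply: (@ler_addeps_mul _ _ _ (beta ^+ 2 * `|y| ^+ 2 / `|s|)) => t t0.
rewrite add0r.
apply: le_trans (lerD (norm_deriv_le_quot s (- y) t0) (norm_deriv_le_quot s y t0)) _.
rewrite /norm_quot scalerN -mulrDl ler_pdivrMr//.
rewrite mulrA mulrAC ler_pdivlMr//.
have := beta_smooth_sqr s (t *: y); rewrite normrZ (gtr0_norm t0) exprMn.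
have := ler_normD (s + t *: y) (s - t *: y).
have -> : s + t *: y + (s - t *: y) = 2 *: s.
  by rewrite addrACA subrr addr0 scaler_nat mulr2n.
rewrite normrZ ger0_norm//.
set a := `|_ + _|; set b := `|_ - _|; set c := `|s| in c0 *.
set q := `|y| => H1 H2.
have := sqr_ge0 (a - b); have := sqr_ge0 (a + b - 2 * c).
nra.
Qed.

Lemma norm_deriv_linear s t y z : s != 0 ->
  norm_deriv s (t *: y + z) = t * norm_deriv s y + norm_deriv s z.
Proof.
move=> s0.
have D y' z' : norm_deriv s (y' + z') = norm_deriv s y' + norm_deriv s z'.
  apply/eqP; rewrite eq_le norm_deriv_subadd /=.
  have := norm_deriv_subadd s (- y') (- z').
  by rewrite -opprD !norm_derivN//; lra.
rewrite D; congr (_ + _).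
have [t0|t0] := leP 0 t; first exact: norm_derivZ_ge0.
have -> : t *: y = - ((- t) *: y) by rewrite scaleNr opprK.
by rewrite norm_derivN// norm_derivZ_ge0 ?oppr_ge0 ?(ltW t0)// mulNr opprK.
Qed.

Lemma norm_deriv_cont_lin s : s != 0 -> cont_lin_functional (norm_deriv s).
Proof.
move=> s0; split; first by move=> a x y; exact: norm_deriv_linear.
move=> x; apply/cvgrPdist_lt => e e0; near=> z.
have -> : norm_deriv s x - norm_deriv s z = norm_deriv s (x - z).
  by rewrite [x - z]addrC -[- z]scaleN1r norm_deriv_linear// mulN1r addrC.
apply: le_lt_trans (norm_deriv_bound _ _) _.
by near: z; apply: cvgr_dist_lt.
Unshelve. all: by end_near. Qed.

(* Iterating the midpoint inequality along the dyadic points keeps the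
   remainder at [beta ^+ 2 * `|y| ^+ 2]; a single use would double it. *)
Lemma norm_sqr_smooth s y :
  `|s + y| ^+ 2 <= `|s| ^+ 2 + 2 * `|s| * norm_deriv s y + beta ^+ 2 * `|y| ^+ 2.
Proof.
have dyadic k : `|s + y| ^+ 2 - `|s| ^+ 2 <=
    2 ^+ k * (`|s + (2 ^+ k)^-1 *: y| ^+ 2 - `|s| ^+ 2)
    + beta ^+ 2 * `|y| ^+ 2 * (1 - (2 ^+ k)^-1).
  elim: k => [|k IH]; first by rewrite expr0 invr1 scale1r subrr mulr0 addr0 mul1r.
  apply: le_trans IH _.
  set h := (2 ^+ k.+1)^-1 : R.
  have h0 : 0 < h by rewrite invr_gt0 exprn_gt0.
  have hk : (2 ^+ k)^-1 = 2 * h :> R by rewrite /h exprS invfM mulrA divff// mul1r.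
  have kh : 2 ^+ k = (2 * h)^-1 :> R by rewrite -hk invrK.
  have k1h : 2 ^+ k.+1 = h^-1 :> R by rewrite /h invrK.
  rewrite hk kh k1h.
  have := beta_smooth_sqr (s + h *: y) (h *: y).
  rewrite addrK -addrA -scalerDl normrZ (gtr0_norm h0) exprMn.
  have -> : h + h = 2 * h by rewrite mulrDl mul1r.
  set U := `|s + (2 * h) *: y| ^+ 2; set V := `|s + h *: y| ^+ 2.
  set Q := beta ^+ 2; set q := `|y| ^+ 2; set C := `|s| ^+ 2 => H.
  have -> : (2 * h)^-1 * (U - C) + Q * q * (1 - 2 * h) =
     (U - C + Q * q * (1 - 2 * h) * 2 * h) / (2 * h).
    by field; rewrite gt_eqF.
  have -> : h^-1 * (V - C) + Q * q * (1 - h) =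
     (2 * (V - C) + Q * q * (1 - h) * 2 * h) / (2 * h).
    by field; rewrite gt_eqF.
  by rewrite ler_pM2r ?invr_gt0 ?mulr_gt0//; lra.
(* Limit along dyadic steps [h]: once [h] is below [e] and [t0], the quotient is within [e] of the
   derivative and [h] times its square is at most [e |y|^2]. *)
apply: (@ler_addeps_mul _ _ _ (2 * `|s| + `|y| ^+ 2)) => e e0.
have [t0 t00 Ht] := norm_deriv_adherent s y e0.
have m0 : 0 < Num.min e t0 by rewrite lt_min e0.
have [k kt] : exists k, (2 ^+ k)^-1 < Num.min e t0.
  exists (Num.bound (Num.min e t0)^-1).
  rewrite -[ltRHS]invrK ltf_pV2 ?posrE ?exprn_gt0 ?invr_gt0//.
  apply: lt_le_trans (archi_boundP _) _; first by rewrite invr_ge0 ltW.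
  by rewrite -natrX ler_nat ltnW// ltn_expl.
have := dyadic k; set h := (2 ^+ k)^-1 in kt * => H.
have h0 : 0 < h by rewrite invr_gt0 exprn_gt0.
move: kt; rewrite lt_min => /andP[he ht0].
have := Ht h; rewrite h0 ltW// => /(_ isT).
have := norm_quot_bound s y h0.
move: H; rewrite (_ : 2 ^+ k = h^-1); last by rewrite /h invrK.
have -> : h^-1 * (`|s + h *: y| ^+ 2 - `|s| ^+ 2) =
   2 * `|s| * norm_quot s y h + h * norm_quot s y h ^+ 2.
  by rewrite /norm_quot; field; rewrite gt_eqF.
set r := norm_quot s y h => H1 H2 H3.
have : r ^+ 2 <= `|y| ^+ 2 by rewrite -[r ^+ 2]real_normK ?num_real// lerXn2r ?nnegrE.
have := normr_ge0 s; have := sqr_ge0 r; have := sqr_ge0 beta; have := sqr_ge0 `|y|.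
move: H1 H2 H3 he.
set q := `|y| ^+ 2; set Q := beta ^+ 2; set c := `|s|; set D := norm_deriv s y.
set rr := r ^+ 2 => H1 H2 H3 he q0 Q0 rr0 c0 rq.
have hq : h * rr <= e * q by apply: ler_pM => //; rewrite ltW.
have cc : c * r <= c * (D + e) by rewrite ler_wpM2l// ltW.
have := mulr_ge0 (mulr_ge0 Q0 q0) (ltW h0).
lra.
Qed.

(** Used with [c = |s|], [G = |s + y|] and [r] the derivative. For [x = G - c] the quadratic
    hypothesis is [x^2 + 2 c (x - r) <= Q]; its part [2 c (x - r)] absorbs the excess
    [sinh c (x - r)], because [sinh c <= c cosh c] and [exp_rem M >= 1/2]. *)
Lemma coshR_smooth_scalar (c G r Q M : R) : 0 <= c -> 0 < M -> `|G - c| <= M ->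
  r <= G - c -> G ^+ 2 <= c ^+ 2 + 2 * c * r + Q ->
  coshR G <= coshR c + sinhR c * r + coshR c * Q * exp_rem M.
Proof.
move=> c0 M0 GM rG GQ.
have := coshRD_le c0 GM M0; rewrite addrC subrK.
have /andP[_ sc] := sinhR_bounds c0.
have := exp_rem_ge_half M0; have := coshR_gt0 c.
set C := coshR c in sc *; set S := sinhR c in sc *; set f := exp_rem M.
move=> C0 f0; have f1 : 0 < f by lra.
pose x := G - c; have {GQ}GQ : x ^+ 2 + 2 * c * (x - r) <= Q by rewrite /x; lra.
rewrite -/x in rG GM * => H; apply: le_trans H _.
have H1 : C * f * (x ^+ 2 + 2 * c * (x - r)) <= C * f * Q.
  by rewrite ler_wpM2l// mulr_ge0// ltW.
have H2 : S * (x - r) <= C * f * (2 * c * (x - r)).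
  rewrite mulrA ler_wpM2r ?subr_ge0//; apply: le_trans sc _.
  have : 0 <= c * C by rewrite mulr_ge0// ltW.
  nra.
lra.
Qed.

Lemma coshR_norm_smooth s y M : 0 < M -> `|y| <= M ->
  coshR `|s + y| <= coshR `|s| + sinhR `|s| * norm_deriv s y
    + coshR `|s| * (beta ^+ 2 * `|y| ^+ 2) * exp_rem M.
Proof.
move=> M0 yM; apply: coshR_smooth_scalar => //.
- by apply: le_trans (ler_dist_dist _ _) _; rewrite addrAC subrr add0r.
- exact: norm_deriv_subgradient.
- by have := norm_sqr_smooth s y; lra.
Qed.

Lemma coshR_norm_convex s y :
  coshR `|s| + sinhR `|s| * norm_deriv s y <= coshR `|s + y|.
Proof.
apply: le_trans (coshR_tangent `|s| `|s + y|).
by rewrite lerD2l ler_wpM2l ?sinhR_ge0 ?norm_deriv_subgradient.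
Qed.

(** At [s = 0], where the norm derivative is not linear, the factor [sinh |s|] vanishes, so every
    base point is covered. *)
Lemma sinhR_norm_deriv_cont_lin s :
  cont_lin_functional (fun y => sinhR `|s| * norm_deriv s y).
Proof.
have [->|s0] := eqVneq s 0.
  rewrite normr0 sinhR0; split => [a x y|x]; first by rewrite !mul0r mulr0 addr0.
  by under eq_fun do rewrite mul0r; exact: cvg_cst.
have [lin cont] := norm_deriv_cont_lin s0.
split=> [a x y|x]; first by rewrite lin; ring.
by apply: cvgM; [exact: cvg_cst|exact: cont].
Qed.

End norm_derivative.

(** * Truncation *)

Section power_inequalities.
Variables (R : realType) (p : R).
Hypothesis p1 : 1 < p.
Implicit Types x b z : R.

Let p0 : 0 < p. Proof. exact: lt_trans ltr01 p1. Qed.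

(** Young's inequality for [x] and [b^(p-1)]; the exponent conjugate to [p] is [p / (p - 1)]. *)
Lemma powR_young_tangent x b : 0 <= x -> 0 <= b ->
  x * b `^ (p - 1) <= x `^ p / p + (1 - p^-1) * b `^ p.
Proof.
move=> x0 b0; have q0 : 0 < 1 - p^-1 by rewrite subr_gt0 invf_lt1.
have := @conjugate_powR R x (b `^ (p - 1)) p (1 - p^-1)^-1 x0 (powR_ge0 _ _) p0.
rewrite invr_gt0 invrK => /(_ q0) /(_ ltac:(ring)).
rewrite -powRrM (_ : (p - 1) / (1 - p^-1) = p) 1?[_ * b `^ p]mulrC//.
by field; rewrite !gt_eqF//= subr_gt0.
Qed.

Lemma Kp_gt0 : 0 < Kp p.
Proof. by rewrite /Kp mulr_gt0 ?invr_gt0// powR_gt0// divr_gt0// subr_gt0. Qed.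

(** The line [z - 1] is the tangent to [Kp p * z^p] at [q = p / (p - 1)], so Young's inequality is
    applied at that point. *)
Lemma sub1_le_Kp z : 0 <= z -> z - 1 <= Kp p * z `^ p.
Proof.
move=> z0; pose q := p / (p - 1).
have q0 : 0 < q by rewrite divr_gt0// subr_gt0.
have := powR_young_tangent z0 (ltW q0).
rewrite -(mulr_powRB1 (ltW q0) p0).
have -> : (1 - p^-1) * (q * q `^ (p - 1)) = q `^ (p - 1).
  rewrite mulrA (_ : (1 - p^-1) * q = 1) ?mul1r// /q.
  by field; rewrite !gt_eqF//= subr_gt0.
have E : ((p - 1) / p) `^ (p - 1) * q `^ (p - 1) = 1.
  rewrite -powRM ?(ltW q0)//; last by rewrite divr_ge0// ?(ltW p0)// subr_ge0 ltW.
  rewrite (_ : _ * q = 1) ?powR1// /q.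
  by field; rewrite !gt_eqF//= subr_gt0.
have Q0 : 0 < q `^ (p - 1) by rewrite powR_gt0.
move=> H; rewrite -(ler_pM2r Q0) /Kp.
have -> : p^-1 * ((p - 1) / p) `^ (p - 1) * z `^ p * q `^ (p - 1) =
  z `^ p / p * (((p - 1) / p) `^ (p - 1) * q `^ (p - 1)) by ring.
rewrite E; lra.
Qed.

Lemma pow2_Kp_ge1 : 1 <= 2 `^ p * Kp p.
Proof. by have := sub1_le_Kp (ler0n R 2); lra. Qed.

Lemma sqr_le_powR z : p <= 2 -> 0 <= z <= 1 -> z ^+ 2 <= z `^ p.
Proof.
move=> p2 /andP[+ z1]; rewrite le_eqVlt => /predU1P[<-|z0].
  by rewrite powR0 ?expr0n//= gt_eqF.
by rewrite -powR_mulrn ?(ltW z0)// ger_powR// z0.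
Qed.

End power_inequalities.

(** Apply [1 - y <= e^(-y)] at [y = 5/32] and raise to the fourth power: [(32/27)^4 < 2]. The
    rational threshold lies below [log 2] and still suffices for [large_mean_scalar]. *)
Lemma expR_le2 {R : realType} (x : R) : x <= 5 / 8 -> expR x <= 2.
Proof.
move=> x58; apply: (@le_trans _ _ (expR (5 / 8))); first by rewrite ler_expR.
have -> : (5 / 8 : R) = - (4%:R * - (5 / 32)) by field.
rewrite expRN expRM_natl.
have H : 27 / 32 <= expR (- (5 / 32)) :> R.
  by have := @expR_ge1Dx R (- (5 / 32)); lra.
have H4 : (27 / 32) ^+ 4 <= expR (- (5 / 32)) ^+ 4 :> R.
  by apply: lerXn2r H; rewrite nnegrE ?expR_ge0// divr_ge0.
rewrite -[leRHS]invrK lef_pV2 ?posrE ?invr_gt0 ?exprn_gt0 ?expR_gt0//.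
by apply: le_trans H4; lra.
Qed.

Section truncation.
Variables (R : realType) (B : normedModType R) (lam : R).
Hypothesis lam0 : 0 < lam.
Implicit Types x : B.

Definition truncate x : B := Trunc (lam *: x) *: x.

Lemma TruncE x : Trunc (lam *: x) = (Num.max 1 (lam * `|x|))^-1.
Proof.
rewrite /Trunc; have [/eqP E|x0] := eqVneq (lam *: x) 0.
  have : lam * `|x| = 0 by rewrite -(gtr0_norm lam0) -normrZ (eqP E) normr0.
  by move=> ->; rewrite max_l// invr1.
have : 0 < lam * `|x| by rewrite -(gtr0_norm lam0) -normrZ normr_gt0.
rewrite normrZ (gtr0_norm lam0) => z0.
have [z1|z1] := leP (lam * `|x|) 1.
  by rewrite invr1 min_l// invf_ge1.
by rewrite min_r// invf_le1// ltW.
Qed.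

Let max_gt0 (z : R) : 0 < Num.max 1 z. Proof. by rewrite lt_max ltr01. Qed.

Lemma norm_truncate x :
  lam * `|truncate x| = lam * `|x| / Num.max 1 (lam * `|x|).
Proof.
by rewrite /truncate TruncE normrZ gtr0_norm ?invr_gt0// mulrCA mulrC.
Qed.

Lemma norm_truncate_le1 x : lam * `|truncate x| <= 1.
Proof. by rewrite norm_truncate ler_pdivrMr// mul1r le_max lexx orbT. Qed.

(** With [z = lam |x|] this is [min(z, 1)^2 <= z^p]: by [p <= 2] below [1], and by [z^p >= 1]
    above. *)
Lemma norm_truncate_sqr (p : R) x : 1 < p <= 2 ->
  lam ^+ 2 * `|truncate x| ^+ 2 <= (lam * `|x|) `^ p.
Proof.
move=> /andP[p1 p2]; rewrite -exprMn norm_truncate.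
have z0 : 0 <= lam * `|x| by rewrite mulr_ge0// ltW.
have [z1|z1] := leP (lam * `|x|) 1; first by rewrite divr1 sqr_le_powR// z0.
rewrite divff ?gt_eqF ?(lt_trans ltr01)// expr1n.
by rewrite -(powRr0 (lam * `|x|)) ler_powR ?(ltW z1)// (le_trans ler01)// ltW.
Qed.

(** The left side is the positive part of [lam |x| - 1], to which [sub1_le_Kp] applies. *)
Lemma norm_truncate_bias (p : R) x : 1 < p ->
  lam * `|x - truncate x| <= Kp p * (lam * `|x|) `^ p.
Proof.
move=> p1; have z0 : 0 <= lam * `|x| by rewrite mulr_ge0// ltW.
rewrite /truncate TruncE -[X in X - _]scale1r -scalerBl normrZ.
have [z1|z1] := leP (lam * `|x|) 1.
  by rewrite invr1 subrr normr0 mul0r mulr0 mulr_ge0 ?powR_ge0 ?ltW ?Kp_gt0.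
apply: le_trans (sub1_le_Kp p1 z0).
rewrite ger0_norm ?subr_ge0 ?invf_le1 ?(lt_trans ltr01) ?(ltW z1)//.
rewrite mulrCA mulrBl mul1r mulVf// gt_eqF// (lt_trans ltr01)//.
Qed.

Lemma truncate_continuous : continuous truncate.
Proof.
have -> : truncate = fun x => (Num.max 1 (lam * `|x|))^-1 *: x.
  by apply/funext => x; rewrite /truncate TruncE.
move=> x; apply: cvgZ; last exact: cvg_id.
apply: cvgV; first by rewrite gt_eqF.
apply: (@continuous_max _ _ (fun=> 1) (fun y : B => lam * `|y|)).
  exact: cvg_cst.
by apply: cvgM; [exact: cvg_cst|exact: norm_continuous].
Qed.

End truncation.

(** * The pointwise one-step inequality *)

Section truncated_step.
Variables (R : realType) (B : normedModType R) (beta lam p : R) (mu : B).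
Hypothesis smooth : beta_smooth B beta.
Hypotheses (beta1 : 1 <= beta) (lam0 : 0 < lam) (p12 : 1 < p <= 2).
Hypothesis mu_small : expR (lam * `|mu|) <= 2.

(* The centre [mu] is moved into the base point: convexity of [cosh] at
   [s - (lam / beta) *: mu] pays for the shift, so only the uncentred [`|x|]
   enters the second-order term. *)
Lemma coshR_truncated_step (s s0 x : B) : s = s0 + (lam / beta) *: mu ->
  coshR `|s + (lam / beta) *: (truncate lam x - mu)| <=
  coshR `|s| + lam / beta * (sinhR `|s0| * norm_deriv s0 (x - mu))
  + 2 * coshR `|s| * (Kp p / beta + exp_rem beta^-1) * (lam * `|x|) `^ p.
Proof.
move=> sE; have b0 : 0 < beta := lt_le_trans ltr01 beta1.
have a0 : 0 < lam / beta by rewrite divr_gt0.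
have p1 : 1 < p by case/andP: p12.
pose Y := truncate lam x.
have -> : s + (lam / beta) *: (truncate lam x - mu) = s0 + (lam / beta) *: Y.
  by rewrite sE scalerBr addrAC addrA subrK.
have [glin _] := sinhR_norm_deriv_cont_lin smooth s0.
pose g (y : B) := sinhR `|s0| * norm_deriv s0 y.
have gZ a y z : g (a *: y + z) = a * g y + g z by exact: glin.
have g0 : g 0 = 0 by have := gZ (-1) 0 0; rewrite scaler0 addr0; lra.
have gsc a y : g (a *: y) = a * g y by have := gZ a y 0; rewrite addr0 g0 addr0.
have gB y z : g (y - z) = g y - g z.
  by rewrite addrC -scaleN1r gZ mulN1r addrC.
have nY : `|(lam / beta) *: Y| = beta^-1 * (lam * `|Y|).
  by rewrite normrZ gtr0_norm// [lam / _]mulrC mulrA.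
have Yle : `|(lam / beta) *: Y| <= beta^-1.
  by rewrite nY ler_piMr ?invr_ge0 ?(ltW b0)// norm_truncate_le1.
have bi0 : 0 < beta^-1 by rewrite invr_gt0.
have := coshR_norm_smooth smooth s0 bi0 Yle.
have := coshR_norm_convex s0 ((lam / beta) *: mu); rewrite -sE.
rewrite -!/(g _) 2!gsc gB.
have -> : beta ^+ 2 * `|(lam / beta) *: Y| ^+ 2 = lam ^+ 2 * `|Y| ^+ 2.
  by rewrite nY; field; rewrite gt_eqF.
(* Passing from the truncated to the raw variable inside the functional costs the truncation
   bias. *)
have gY : g Y <= g x + coshR `|s0| * `|x - Y|.
  rewrite -lerBlDl -gB /g; apply: (@le_trans _ _ (sinhR `|s0| * `|x - Y|)).
    rewrite ler_wpM2l ?sinhR_ge0// distrC.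
    exact: le_trans (ler_norm _) (norm_deriv_bound _ _).
  by rewrite ler_wpM2r// sinhR_le_coshR.
have {gY} := ler_wpM2l (ltW a0) gY.
have bias := norm_truncate_bias lam0 x p1.
have sqr := norm_truncate_sqr lam0 x p12.
have C0 := coshR_gt0 `|s0|.
(* Return from [s0] to [s]: the shift has norm at most [lam |mu|] because [beta >= 1], so the factor
   is [e^(lam |mu|) <= 2]. *)
have C02 : coshR `|s0| <= 2 * coshR `|s|.
  apply: (@le_trans _ _ (expR (lam * `|mu|) * coshR `|s|)).
    apply: coshR_le_expR => //; last by rewrite mulr_ge0// ltW.
    rewrite (_ : s0 = s - (lam / beta) *: mu); last by rewrite sE addrK.
    apply: le_trans (ler_normB _ _) _; rewrite lerD2l normrZ gtr0_norm//.
    by rewrite ler_wpM2r// ler_pdivrMr// ler_peMr// ltW.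
  by rewrite ler_wpM2r// ltW// coshR_gt0.
have f0 : 0 <= exp_rem beta^-1 by apply: le_trans (exp_rem_ge_half bi0).
rewrite -/Y in bias sqr.
have {}bias := ler_wpM2r (ltW bi0) bias.
have {}bias := ler_wpM2l (ltW C0) bias.
have {}sqr := ler_wpM2r f0 sqr.
have {}sqr := ler_wpM2l (ltW C0) sqr.
have kf0 : 0 <= (Kp p / beta + exp_rem beta^-1) * (lam * `|x|) `^ p.
  apply: mulr_ge0 (powR_ge0 _ _); apply: addr_ge0 => //.
  by apply: mulr_ge0; rewrite ltW// Kp_gt0.
have := ler_wpM2r kf0 C02.
set Z := _ `^ _ in sqr bias *; set f := exp_rem _ in sqr f0 *.
set q := `|Y| ^+ 2 in sqr *.
set C1 := coshR `|s0| in C0 C02 bias sqr *; set C := coshR `|s|.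
set k := Kp p in bias *; move: bias sqr.
lra.
Qed.

End truncated_step.

(** * Borel maps with respect to a sub-sigma-algebra *)

(** Stated for a bare family [G] of sets, so that all the [F n] live on the one carrier [T]. *)
Definition borel_wrt {T : Type} {V : topologicalType} (G : set (set T)) (f : T -> V) :=
  forall U : set V, open U -> G (f @^-1` U).

Lemma separable_dense_seq {R : realType} (B : normedModType R) : separable B ->
  exists e : nat -> B, forall x eps, 0 < eps -> exists n, `|x - e n| < eps.
Proof.
move=> [D [/countable_injP[f finj] clD]].
(* Indices outside the image of [f] receive the default [0]. *)
exists (fun n => xget 0 [set x | D x /\ f x = n]) => x eps eps0.
have : closure D x by rewrite clD.
move=> /(_ (ball x eps)) []; first exact: nbhsx_ballx.
move=> y [Dy xy]; exists (f y); case: xgetP => [z _ [Dz fzy]|/(_ y)]; last by case.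
by rewrite (finj z y) ?inE//; move: xy; rewrite -ball_normE.
Qed.

Section sub_sigma_algebra.
Variables (T : Type) (G : set (set T)).
Hypothesis sG : sigma_algebra setT G.
Implicit Types A C : set T.

Lemma sigmaA_set0 : G set0. Proof. by case: sG. Qed.

Lemma sigmaA_setC A : G A -> G (~` A).
Proof. by case: sG => _ + _ => /[apply]; rewrite setTD. Qed.

Lemma sigmaA_setT : G setT.
Proof. by rewrite -setC0; exact/sigmaA_setC/sigmaA_set0. Qed.

Lemma sigmaA_bigcup (A : nat -> set T) : (forall n, G (A n)) -> G (\bigcup_n A n).
Proof. by case: sG => _ _; apply. Qed.

Lemma sigmaA_bigcap (A : nat -> set T) : (forall n, G (A n)) -> G (\bigcap_n A n).
Proof.
by move=> GA; rewrite -[X in G X]setCK setC_bigcap; apply/sigmaA_setC/sigmaA_bigcup => n; exact/sigmaA_setC.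
Qed.

Lemma sigmaA_setI A C : G A -> G C -> G (A `&` C).
Proof.
move=> GA GC; rewrite -bigcap2E; apply: sigmaA_bigcap => -[|[|n]] //=.
exact: sigmaA_setT.
Qed.

Lemma sigmaA_setD A C : G A -> G C -> G (A `\` C).
Proof. by move=> GA GC; rewrite setDE; apply: sigmaA_setI => //; exact: sigmaA_setC. Qed.

Lemma sigmaA_seqDU (A : nat -> set T) n : (forall n, G (A n)) -> G (seqDU A n).
Proof.
move=> GA; apply: sigmaA_setD => //; rewrite -bigcup_mkord.
rewrite bigcup_mkcond; apply: sigmaA_bigcup => k; case: ifP => // _; exact: sigmaA_set0.
Qed.

Lemma borel_wrt_cst (V : topologicalType) (a : V) : borel_wrt G (fun=> a).
Proof.
move=> U oU; have [Ua|Ua] := pselect (U a).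
  rewrite (_ : _ @^-1` _ = setT); first exact: sigmaA_setT.
  by apply/seteqP; split.
by rewrite (_ : _ @^-1` _ = set0); [exact: sigmaA_set0|apply/seteqP; split].
Qed.

Lemma borel_wrt_comp (V W : topologicalType) (h : V -> W) (f : T -> V) :
  continuous h -> borel_wrt G f -> borel_wrt G (h \o f).
Proof. by move=> /continuousP ch Gf U oU; rewrite comp_preimage; exact/Gf/ch. Qed.

(** Separability writes the preimage as a countable union over approximating centres [e i], [e j]
    and radii [1 / (k + 1)]. *)
Lemma borel_wrtD (R : realType) (B : normedModType R) (f g : T -> B) :
  separable B -> borel_wrt G f -> borel_wrt G g -> borel_wrt G (f \+ g).
Proof.
move=> /separable_dense_seq[e edense] Gf Gg U oU.
pose C i j k := if `[< ball (e i + e j) (2 / k.+1%:R) `<=` U >] then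
  f @^-1` ball (e i) k.+1%:R^-1 `&` g @^-1` ball (e j) k.+1%:R^-1 else set0.
rewrite (_ : _ @^-1` _ = \bigcup_i \bigcup_j \bigcup_k C i j k).
  apply: sigmaA_bigcup => i; apply: sigmaA_bigcup => j; apply: sigmaA_bigcup => k.
  rewrite /C; case: ifP => _; last exact: sigmaA_set0.
  by apply: sigmaA_setI; [apply: Gf|apply: Gg]; exact: ball_open.
apply/seteqP; split => [w /= Uw|w [i _ [j _ [k _]]]]; last first.
  rewrite /C; case: asboolP => // sub [/= fi gj]; apply: sub.
  move: fi gj; rewrite -!ball_normE/= => fi gj.
  rewrite opprD addrACA; apply: le_lt_trans (ler_normD _ _) _.
  rewrite mulrDl mul1r; exact: ltrD.
have /nbhs_ballP[r /= r0 rU] : nbhs (f w + g w) U by exact: open_nbhs_nbhs.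
(* Two errors of size [2 / (k + 1)] must fit into [r]: from [f w + g w] to [e i + e j], and from
   there across the ball. *)
pose k := Num.bound (4 / r).
have kr : 4 / k.+1%:R < r.
  rewrite ltr_pdivrMr// mulrC -ltr_pdivrMr//.
  apply: (@lt_trans _ _ k%:R); last by rewrite ltr_nat.
  by apply: archi_boundP; rewrite divr_ge0// ltW.
have k0 : 0 < k.+1%:R^-1 :> R by rewrite invr_gt0.
have [i fi] := edense (f w) _ k0; have [j gj] := edense (g w) _ k0.
exists i => //; exists j => //; exists k => //; rewrite /C.
case: asboolP => [_|[]]; first by split; rewrite /preimage/= -ball_normE/= distrC.
move=> z; rewrite -ball_normE/= => ez; apply: rU; rewrite -ball_normE/=.
rewrite -(subrK (e i + e j) (f w + g w)) -addrA.
apply: le_lt_trans (ler_normD _ _) _; apply: lt_trans kr.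
have : `|f w + g w - (e i + e j)| < 2 / k.+1%:R.
  rewrite opprD addrACA; apply: le_lt_trans (ler_normD _ _) _.
  by rewrite mulrDl mul1r; exact: ltrD.
move=> fge; rewrite (_ : 4 / _ = 2 / k.+1%:R + 2 / k.+1%:R); first exact: ltrD.
by rewrite -mulrDl -natrD.
Qed.

End sub_sigma_algebra.

Lemma borel_wrt_measurable {d} {T : measurableType d} {R : realType} (f : T -> R) :
  borel_wrt measurable f -> measurable_fun setT f.
Proof.
move=> mf; apply: (measurability _ (RGenOpens.measurableE R)).
move=> _ [_ [x [y ->]] <-]; rewrite setTI; apply: mf; exact: interval_open.
Qed.

Lemma borel_wrt_le {T : Type} {R : realType} (G : set (set T)) (f : T -> R) a : sigma_algebra setT G ->
  borel_wrt G f -> G [set w | f w <= a].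
Proof.
move=> sG Gf; rewrite (_ : [set _ | _] = ~` (f @^-1` `]a, +oo[)).
  by apply: sigmaA_setC => //; apply: Gf; exact: interval_open.
apply/seteqP; split => w /=; rewrite in_itv/= andbT; first by move=> /le_gtF ->.
by move=> /negP; rewrite -leNgt.
Qed.

(** * One step of the walk *)

Section conditional_step.
Context {d : measure_display} {T : measurableType d} {R : realType}.
Variables (P : probability T R) (B : normedModType R) (G : set (set T)).
Variables (X : T -> B) (mu : B) (p v : R).
Hypotheses (sG : sigma_algebra setT G) (Gm : G `<=` measurable).
Hypothesis mX : borel_wrt measurable X.
Hypothesis meanX : forall A, G A -> forall phi : B -> R, cont_lin_functional phi ->
  (\int[P]_(w in A) (phi (X w))%:E = (phi mu)%:E * P A)%E.
Hypothesis momentX : forall A, G A ->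
  (\int[P]_(w in A) (`|X w| `^ p)%:E <= v%:E * P A)%E.
Hypothesis p1 : 1 < p.

Let measurable_X (h : B -> R) : continuous h -> measurable_fun setT (h \o X).
Proof. by move=> ch; apply: borel_wrt_measurable; exact: (borel_wrt_comp ch mX). Qed.

Let measurable_Xp : measurable_fun setT (fun w => `|X w| `^ p).
Proof.
apply: (measurableT_comp (measurable_powR p)).
exact/measurable_X/norm_continuous.
Qed.

Let integrable_Xp : P.-integrable setT (fun w => (`|X w| `^ p)%:E).
Proof.
apply/integrableP; split; first exact/measurable_EFinP.
under eq_integral do rewrite gee0_abs ?lee_fin ?powR_ge0//.
apply: le_lt_trans (momentX (sigmaA_setT sG)) _.
by rewrite probability_setT mule1 ltry.
Qed.

(** Integrating the pointwise bound over [A] cancels the centred functional by [meanX] and leaves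
    [v] by [momentX]. The bound by [K] makes [psi (X w)] integrable, through [|X| <= 1 + |X|^p]. *)
Lemma integral_cond_le (f : T -> R) (psi : B -> R) (a c K : R) A : G A ->
  measurable_fun setT f -> (forall w, 0 <= f w) ->
  cont_lin_functional psi -> 0 <= K -> (forall y, `|psi y| <= K * `|y|) -> 0 <= c ->
  (forall w, f w <= a + (psi (X w) - psi mu) + c * `|X w| `^ p) ->
  (\int[P]_(w in A) (f w)%:E <= (a + c * v)%:E * P A)%E.
Proof.
move=> GA mf f0 psilin K0 psiK c0 fle.
have mA := Gm GA.
have [_ cpsi] := psilin.
have mpsi := measurable_X cpsi.
have ipsi : P.-integrable setT (fun w => (psi (X w))%:E).
  apply: (@le_integrable _ _ _ _ _ _ _
    (fun w => (K%:E * ((cst 1 w)%:E + (`|X w| `^ p)%:E))%E)) => //.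
  - exact/measurable_EFinP.
  - move=> w _ /=; rewrite lee_fin [leRHS]ger0_norm ?mulr_ge0 ?addr_ge0 ?powR_ge0//.
    apply: le_trans (psiK _) _; rewrite ler_wpM2l//.
    have [x1|x1] := leP `|X w| 1.
      by rewrite (le_trans x1)// lerDl powR_ge0.
    by rewrite (le_trans (le1r_powR (ltW x1) (ltW p1)))// lerDr.
  - apply: integrableZl => //; apply: integrableD => //.
    exact: finite_measure_integrable_cst.
have sub (g : T -> \bar R) : P.-integrable setT g -> P.-integrable A g.
  by apply: integrableS.
have {}ipsi := sub _ ipsi; have iXp := sub _ integrable_Xp.
have icst : P.-integrable A (EFin \o cst (a - psi mu)).
  exact: finite_measure_integrable_cst.
have icXp : P.-integrable A (fun w => (c%:E * (`|X w| `^ p)%:E)%E).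
  exact: integrableZl.
pose h w := ((a - psi mu)%:E + ((psi (X w))%:E + c%:E * (`|X w| `^ p)%:E))%E.
have ih : P.-integrable A h.
  by apply: integrableD => //; exact: integrableD.
apply: (@le_trans _ _ (\int[P]_(w in A) h w)%E).
  apply: ge0_le_integral => //.
  - by move=> w _; rewrite lee_fin.
  - by apply/measurable_EFinP; exact: measurable_funTS.
  - by case/integrableP: ih.
  - move=> w _; rewrite /h lee_fin; apply: le_trans (fle w) _.
    by rewrite le_eqVlt; apply/orP; left; apply/eqP; ring.
rewrite /h integralD//; last exact: integrableD.
rewrite integralD// (meanX GA psilin) integralZl//.
rewrite (_ : (\int[P]_(x in A) (a - psi mu)%:E)%E = ((a - psi mu)%:E * P A)%E); last first.
  exact: (integral_cst P mA).
have := momentX GA.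
have /fineK <- : P A \is a fin_num by exact: fin_num_measure.
move=> H.
apply: (@le_trans _ _ ((a - psi mu)%:E * (fine (P A))%:E + ((psi mu)%:E * (fine (P A))%:E
   + c%:E * (v%:E * (fine (P A))%:E)))%E).
  by rewrite leeD2l// leeD2l// lee_wpmul2l// lee_fin.
by rewrite -!EFinM -!EFinD lee_fin le_eqVlt; apply/orP; left; apply/eqP; ring.
Qed.

(** Jensen's inequality through a supporting functional: [k] times the norm derivative at [mu], with
    [k = p |mu|^(p-1)], supports [|.|^p] at [mu], by Young's inequality. *)
Lemma norm_mean_powR_le (beta : R) : beta_smooth B beta -> 0 <= v -> `|mu| `^ p <= v.
Proof.
move=> smooth v0; have [->|mu0] := eqVneq mu 0.
  by rewrite normr0 powR0// gt_eqF// (lt_trans ltr01).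
have p0 : 0 < p by exact: lt_trans ltr01 p1.
pose k := p * `|mu| `^ (p - 1); have k0 : 0 <= k by rewrite mulr_ge0 ?powR_ge0 ?ltW.
have [lin cont] := norm_deriv_cont_lin smooth mu0.
suff : (\int[P]_(w in setT) (`|mu| `^ p)%:E <= (0 + 1 * v)%:E * P setT)%E.
  have -> : (\int[P]_(w in setT) (`|mu| `^ p)%:E = (`|mu| `^ p)%:E * P setT)%E.
    exact: (integral_cst P).
  by rewrite probability_setT !mule1 lee_fin add0r mul1r.
apply: (@integral_cond_le (fun=> `|mu| `^ p) (fun y => - k * norm_deriv mu y) 0 1 k) => //.
- exact: sigmaA_setT.
- split=> [a x y|x]; first by rewrite lin; ring.
  by apply: cvgM; [exact: cvg_cst|exact: cont].
- move=> y; rewrite normrM normrN (ger0_norm k0) ler_wpM2l//.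
  exact: norm_deriv_bound.
move=> w; rewrite norm_deriv_self add0r mul1r.
have kmu : k * `|mu| = p * `|mu| `^ p.
  by rewrite /k -mulrA [_ * `|mu|]mulrC mulr_powRB1.
have := powR_young_tangent p1 (normr_ge0 (X w)) (normr_ge0 mu).
move/(ler_wpM2l (ltW p0)).
rewrite (_ : p * (`|X w| `^ p / p + (1 - p^-1) * `|mu| `^ p) =
  `|X w| `^ p + (p - 1) * `|mu| `^ p); last by field; rewrite gt_eqF.
rewrite mulrCA -/k => H.
have := ler_wpM2l k0 (le_trans (ler_norm _) (norm_deriv_bound mu (X w))).
rewrite !mulNr opprK kmu; lra.
Qed.

(** Here the position [s] is deterministic; [integral_coshR_adapted_step] makes it random. *)
Lemma integral_coshR_truncated_step (beta lam : R) (s : B) A :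
  beta_smooth B beta -> 1 <= beta -> 0 < lam -> p <= 2 ->
  expR (lam * `|mu|) <= 2 -> G A ->
  (\int[P]_(w in A) (coshR `|s + (lam / beta) *: (truncate lam (X w) - mu)|)%:E <=
   ((1 + 2 * (Kp p / beta + exp_rem beta^-1) * lam `^ p * v) * coshR `|s|)%:E * P A)%E.
Proof.
move=> smooth b1 lam0 p2 mu2 GA; have b0 := lt_le_trans ltr01 b1.
pose s0 := s - (lam / beta) *: mu.
have [lin cont] := sinhR_norm_deriv_cont_lin smooth s0.
have l0 : 0 <= lam / beta by rewrite divr_ge0// ltW.
have S0 : 0 <= sinhR `|s0| by rewrite sinhR_ge0.
have kf0 : 0 <= Kp p / beta + exp_rem beta^-1.
  apply: addr_ge0; first by rewrite divr_ge0 ?(ltW (Kp_gt0 p1)) ?(ltW b0).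
  have : 0 < beta^-1 by rewrite invr_gt0.
  by move/exp_rem_ge_half; exact: le_trans.
pose c := 2 * coshR `|s| * (Kp p / beta + exp_rem beta^-1) * lam `^ p.
have -> : (1 + 2 * (Kp p / beta + exp_rem beta^-1) * lam `^ p * v) * coshR `|s| =
  coshR `|s| + c * v by rewrite /c; ring.
apply: (@integral_cond_le _ (fun y => lam / beta * (sinhR `|s0| * norm_deriv s0 y))
  _ _ (lam / beta * sinhR `|s0|)) => //.
- apply: (@measurable_X (fun y => coshR `|s + (lam / beta) *: (truncate lam y - mu)|)) => x.
  apply: (@continuous_comp _ _ _ (fun y => s + (lam / beta) *: (truncate lam y - mu))
    (fun z => coshR `|z|)).
    apply: cvgD; first exact: cvg_cst.
    apply: cvgZr; apply: cvgB; last exact: cvg_cst.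
    exact: truncate_continuous.
  exact: coshR_norm_continuous.
- by move=> w; rewrite ltW// coshR_gt0.
- split=> [a x y|x]; first by rewrite lin; ring.
  by apply: cvgM; [exact: cvg_cst|exact: cont].
- exact: mulr_ge0.
- move=> y; rewrite mulrA normrM (ger0_norm (mulr_ge0 l0 S0)).
  apply: ler_wpM2l; first exact: mulr_ge0.
  exact: norm_deriv_bound.
- apply: mulr_ge0 (powR_ge0 _ _); apply: mulr_ge0 kf0.
  by apply: mulr_ge0 => //; rewrite ltW// coshR_gt0.
move=> w; have sE : s = s0 + (lam / beta) *: mu by rewrite /s0 subrK.
have p12 : 1 < p <= 2 by rewrite p1.
have := coshR_truncated_step smooth b1 lam0 p12 mu2 (X w) sE.
rewrite (powRM _ (ltW lam0) (normr_ge0 _)) /c.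
have -> : sinhR `|s0| * norm_deriv s0 (X w - mu) =
  sinhR `|s0| * norm_deriv s0 (X w) - sinhR `|s0| * norm_deriv s0 mu.
  by rewrite addrC -scaleN1r lin; ring.
move=> /le_trans; apply; rewrite le_eqVlt; apply/orP; left; apply/eqP; ring.
Qed.

End conditional_step.

(** * Maximal inequality *)

(** Stated in the extended reals, so that it applies to integrals before their finiteness is known;
    if [I] is infinite, [k > 0] makes the right side infinite. *)
Lemma lee_mul_addeps {R : realType} (J I : \bar R) (k : R) : 0 < k ->
  (0 <= J)%E -> (0 <= I)%E ->
  (forall e, 0 < e -> (J <= ((1 + e) * k)%:E * I)%E) -> (J <= k%:E * I)%E.
Proof.
move=> k0; case: I => [r| |] //.
- move=> + _; case: J => [j| |] // _ H; last by have := H 1 ltr01; rewrite -EFinM.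
  rewrite -EFinM lee_fin; apply: (@ler_addeps_mul _ _ _ (k * r)) => e e0.
  have := H e e0; rewrite -EFinM lee_fin; lra.
- by move=> _ _ _; rewrite gt0_muley ?lte_fin// leey.
Qed.

Section adapted_step.
Context {d : measure_display} {T : measurableType d} {R : realType}.
Variables (P : probability T R) (B : normedModType R) (G : set (set T)).
Variables (S Y : T -> B) (k : R).
Hypotheses (sepB : separable B) (sG : sigma_algebra setT G) (Gm : G `<=` measurable).
Hypotheses (GS : borel_wrt G S) (mY : borel_wrt measurable Y) (k0 : 0 < k).
Hypothesis step : forall s A, G A ->
  (\int[P]_(w in A) (coshR `|s + Y w|)%:E <= (k * coshR `|s|)%:E * P A)%E.

Let measurable_cosh (f : T -> B) (D : set T) : borel_wrt measurable f ->
  measurable_fun D (fun w => (coshR `|f w|)%:E).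
Proof.
move=> mf; apply/measurable_EFinP; apply: measurable_funTS.
apply: borel_wrt_measurable.
exact: (borel_wrt_comp coshR_norm_continuous mf).
Qed.

(* Freezing [S] at the points of a dense sequence makes [step] applicable on
   countably many pieces, at the cost of a factor tending to one. *)
Lemma integral_coshR_adapted_step A : G A ->
  (\int[P]_(w in A) (coshR `|S w + Y w|)%:E <=
   k%:E * \int[P]_(w in A) (coshR `|S w|)%:E)%E.
Proof.
move=> GA; have sm := @sigma_algebra_measurable _ T.
have cosh0 (x : B) : (0 <= (coshR `|x|)%:E)%E by rewrite lee_fin ltW// coshR_gt0.
have mS : borel_wrt measurable S by move=> U /GS /Gm.
have mSY : borel_wrt measurable (fun w => S w + Y w) by apply: borel_wrtD.
have msY s : borel_wrt measurable (fun w => s + Y w).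
  by apply: (@borel_wrtD _ _ _ _ _ (cst s)) => //; exact: borel_wrt_cst.
apply: lee_mul_addeps => //; [by apply: integral_ge0|by apply: integral_ge0|].
(* Replacing [S w] by [e i] and then going back costs [expR eps] each time, [1 + eta] in total. *)
move=> eta eta0; pose eps := ln (1 + eta) / 2.
have eps0 : 0 < eps by rewrite divr_gt0// ln_gt0// ltrDl.
have epsE : expR eps * expR eps = 1 + eta.
  by rewrite -expRD /eps -splitr lnK// posrE addr_gt0.
have [e edense] := separable_dense_seq sepB.
pose C i := A `&` S @^-1` ball (e i) eps.
have GC i : G (C i) by apply: sigmaA_setI => //; apply: GS; exact: ball_open.
pose D := seqDU C.
have GD i : G (D i) by exact: sigmaA_seqDU.
have mD i : measurable (D i) by exact: Gm.
have SD i w : D i w -> `|e i - S w| < eps.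
  by case=> -[_ +] _; rewrite /preimage/= -ball_normE.
have AE : A = \bigcup_i D i.
  rewrite -seqDU_bigcup_eq; apply/seteqP; split => [w Aw|w [i _ []]//].
  have [i iw] := edense (S w) eps eps0; exists i => //; split => //.
  by rewrite /preimage/= -ball_normE/= distrC.
have tD : trivIset setT D by exact: trivIset_seqDU.
rewrite AE ge0_integral_bigcup//; last exact: (measurable_cosh mSY).
rewrite [in leRHS]ge0_integral_bigcup//; last exact: (measurable_cosh mS).
rewrite -nneseriesZl; last by move=> i _; apply: integral_ge0.
apply: lee_nneseries => [i _ _|i _]; first exact: integral_ge0.
have ee0 : (0 <= (expR eps)%:E)%E by rewrite lee_fin expR_ge0.
apply: (@le_trans _ _ (\int[P]_(w in D i) ((expR eps)%:E * (coshR `|e i + Y w|)%:E))%E).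
  apply: ge0_le_integral => //.
  - exact: (measurable_cosh mSY).
  - by apply: measurable_funeM; exact: (measurable_cosh (msY (e i))).
  - move=> w Dw; rewrite -EFinM lee_fin; apply: coshR_le_expR (ltW eps0) => //.
    rewrite (_ : S w + Y w = e i + Y w - (e i - S w)); last first.
      by rewrite opprB [RHS]addrC addrA subrK.
    apply: le_trans (ler_normB _ _) _; rewrite lerD2l ltW//; exact: SD.
rewrite ge0_integralZl_EFin ?expR_ge0//; last exact: (measurable_cosh (msY (e i))).
apply: le_trans (lee_wpmul2l ee0 (step (e i) (GD i))) _.
rewrite EFinM -[in leLHS]muleA.
have -> : ((coshR `|e i|)%:E * P (D i))%E = (\int[P]_(w in D i) (coshR `|e i|)%:E)%E.
  by rewrite (integral_cst P).
rewrite -epsE -mulrA (EFinM (expR eps)) -[in leRHS]muleA; apply: lee_wpmul2l => //.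
rewrite [expR eps * k]mulrC (EFinM k) -[in leRHS]muleA; apply: lee_wpmul2l; first by rewrite lee_fin ltW.
rewrite -ge0_integralZl_EFin ?expR_ge0//; last exact: (measurable_cosh mS).
apply: ge0_le_integral => //.
- by apply: measurable_funeM; exact: (measurable_cosh mS).
- move=> w Dw; rewrite -EFinM lee_fin; apply: coshR_le_expR (ltW eps0) => //.
  rewrite -[e i in leLHS](subrK (S w)) addrC.
  apply: le_trans (ler_normD _ _) _; rewrite lerD2l ltW//; exact: SD.
Qed.

End adapted_step.

(** * Ville's inequality with a geometric threshold *)

Section maximal_inequality.
Context {d : measure_display} {T : measurableType d} {R : realType}.
Variables (P : probability T R) (F : nat -> set (set T)) (Z : nat -> T -> R).
Variables (k delta : R).
Hypotheses (filtF : filtration F) (k0 : 0 < k) (delta01 : 0 < delta <= 1).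
Hypotheses (Z_ge0 : forall n w, 0 <= Z n w) (Z0 : forall w, Z 0 w = 1).
Hypothesis FZ : forall n, borel_wrt (F n) (Z n).
Hypothesis stepZ : forall n A, F n A ->
  (\int[P]_(w in A) (Z n.+1 w)%:E <= k%:E * \int[P]_(w in A) (Z n w)%:E)%E.

Let below n := [set w | forall m, (m <= n)%N -> Z m w <= k ^+ m / delta].

Let delta0 : 0 < delta. Proof. by case/andP: delta01. Qed.

Let sF n : sigma_algebra setT (F n). Proof. by case: filtF. Qed.
Let Fm n : F n `<=` measurable. Proof. by case: filtF => _ []. Qed.
Let Fle n m : (n <= m)%N -> F n `<=` F m. Proof. by case: filtF => _ [_]; apply. Qed.

Let F_below n : F n (below n).
Proof.
pose C m := if (m <= n)%N then [set w | Z m w <= k ^+ m / delta] else setT.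
have FC m : F n (C m).
  rewrite /C; case: ifP => [mn|_]; last exact: (sigmaA_setT (sF n)).
  by apply: (Fle mn); exact: (borel_wrt_le _ (sF m) (@FZ m)).
have -> : below n = \bigcap_m C m.
  apply/seteqP; split => w H m => [_|mn]; last by have := H m I; rewrite /C mn.
  by rewrite /C; case: ifP => // mn; exact: H.
exact: (sigmaA_bigcap (sF n) FC).
Qed.

Let measurable_Z n D : measurable_fun D (fun w => (Z n w)%:E).
Proof.
apply/measurable_EFinP; apply: measurable_funTS; apply: borel_wrt_measurable.
by move=> U /(FZ n) /Fm.
Qed.

(** Optional stopping without a stopping time: mass that leaves [below n] is booked at the
    threshold, which is then scaled by [k] at each step. *)
Lemma ville_stopped n :
  (\int[P]_(w in below n) (Z n w)%:E + (k ^+ n / delta)%:E * P (~` below n)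
   <= (k ^+ n)%:E)%E.
Proof.
have Zge0 m w : (0 <= (Z m w)%:E)%E by rewrite lee_fin.
elim: n => [|n IH].
  have -> : below 0 = setT.
    apply/seteqP; split => // w _ [|//] _.
    by rewrite Z0 expr0 mul1r invf_ge1//; case/andP: delta01.
  rewrite setCT measure0 mule0 adde0 expr0.
  under eq_integral do rewrite Z0.
  have -> : (\int[P]_(w in setT) 1%:E = 1%:E * P setT)%E by exact: (integral_cst P).
  by rewrite probability_setT mule1.
have mb m : measurable (below m) by exact: Fm.
have sub : below n.+1 `<=` below n by move=> w H m mn; apply: H; exact: leqW.
(* The event of a first crossing at time [n + 1]; there [Z n.+1] exceeds the threshold, so its
   integral over [D] pays for the probability of [D]. *)
pose D := below n `\` below n.+1.
have mD : measurable D by exact: measurableD.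
have dis : [disjoint below n.+1 & D].
  by apply/disj_setPS => w [? [_ ?]].
have bE : below n = below n.+1 `|` D by rewrite /D setDUK.
have CE : ~` below n.+1 = ~` below n `|` D.
  apply/seteqP; split => [w H|w [H /sub//|[]//]].
  by have [?|?] := pselect (below n w); [right|left].
have PD : ((k ^+ n.+1 / delta)%:E * P D <= \int[P]_(w in D) (Z n.+1 w)%:E)%E.
  have <- : (\int[P]_(w in D) (k ^+ n.+1 / delta)%:E =
    (k ^+ n.+1 / delta)%:E * P D)%E by exact: (integral_cst P).
  apply: ge0_le_integral => //.
  - by move=> w _; rewrite lee_fin divr_ge0 ?exprn_ge0// ltW.
  - move=> w [bn nb]; rewrite lee_fin leNgt; apply/negP => /ltW zle.
    apply: nb => m; rewrite leq_eqVlt => /predU1P[->//|]; exact: bn.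
rewrite CE measureU//; last first.
  by apply/seteqP; split => // w [H []].
  exact: measurableC.
have kd0 : (0 <= (k ^+ n.+1 / delta)%:E)%E by rewrite lee_fin divr_ge0 ?exprn_ge0// ltW.
rewrite ge0_muleDr// [X in (_ + X)%E]addeC addeA.
apply: (@le_trans _ _ (\int[P]_(w in below n) (Z n.+1 w)%:E
   + (k ^+ n.+1 / delta)%:E * P (~` below n))%E).
  rewrite leeD2r// [in leRHS]bE ge0_integral_setU//.
  by rewrite leeD2l.
apply: (@le_trans _ _ (k%:E * (\int[P]_(w in below n) (Z n w)%:E
   + (k ^+ n / delta)%:E * P (~` below n)))%E); last first.
  rewrite [in leRHS]exprS (EFinM k); apply: lee_wpmul2l IH.
  by rewrite lee_fin ltW.
rewrite ge0_muleDr//; last 2 first.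
- exact: integral_ge0.
- by rewrite mule_ge0// lee_fin divr_ge0 ?exprn_ge0// ltW.
apply: leeD; first exact: stepZ.
by rewrite exprS -mulrA (EFinM k) muleA.
Qed.

(** Dropping the integral in [ville_stopped] leaves probability at most [delta] outside [below n],
    uniformly in [n]; continuity from above treats all [n] at once. *)
Lemma ville_geometric :
  ((1 - delta)%:E <= P [set w | forall n, (Z n w <= k ^+ n / delta)%R])%E.
Proof.
have mb m : measurable (below m) by exact: Fm.
have Pb n : ((1 - delta)%:E <= P (below n))%E.
  have PC := probability_setC P (mb n).
  have kn0 : 0 < k ^+ n by rewrite exprn_gt0.
  have : ((k ^+ n / delta)%:E * P (~` below n) <= (k ^+ n)%:E)%E.
    apply: le_trans (ville_stopped n); rewrite leeDr//.
    by apply: integral_ge0 => w _; rewrite lee_fin.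
  rewrite PC; have /fineK <- : P (below n) \is a fin_num by exact: fin_num_measure.
  rewrite -EFinB -EFinM !lee_fin mulrAC ler_pdivrMr// ler_pM2l//; lra.
have -> : [set w | forall n, Z n w <= k ^+ n / delta] = \bigcap_n below n.
  by apply/seteqP; split => [w H n _ m _|w H n]; [exact: H|exact: (H n I n)].
have cvgP : P \o below @ \oo --> P (\bigcap_n below n).
  apply: nonincreasing_cvg_mu => //.
  - by rewrite ltey_eq fin_num_measure.
  - exact: bigcapT_measurable.
  - apply/nonincreasing_seqP => n; apply/subsetPset => w H m mn.
    by apply: H; exact: leqW.
rewrite -(cvg_lim _ cvgP)//; apply: lime_ge; last by apply: nearW => n; exact: Pb.
by apply/cvg_ex; exists (P (\bigcap_n below n)).
Qed.

End maximal_inequality.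

(** * Deviation of the truncated mean *)

Section constants.
Variables (R : realType) (B : normedModType R) (beta p : R).
Hypotheses (beta0 : 0 < beta) (p12 : 1 < p <= 2).

Let p1 : 1 < p. Proof. by case/andP: p12. Qed.

Lemma pow2_ge1 (r : R) : 0 <= r -> 1 <= 2 `^ r.
Proof. by move=> r0; rewrite -[leLHS](powRr0 2) ler_powR// ler1n. Qed.

(** Comparing the exponents [p - 1] and [p + 1] puts both branches above the Hilbert value, from
    which the later estimates start. *)
Lemma Cp_ge : 2 `^ (p - 1) * exp_rem (2 / beta) <= Cp B beta p.
Proof.
rewrite /Cp -[X in _ <= _ * X]/(exp_rem (2 / beta)).
have : 0 < 2 / beta by rewrite divr_gt0.
move=> /exp_rem_ge_half f0; rewrite ler_wpM2r ?(le_trans _ f0)//.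
by case: ifP => // _; rewrite ler_powR ?ler1n//; lra.
Qed.

Definition bias_const := beta * Cp B beta p + Kp p * 2 `^ (p - 1).

Lemma bias_const_gt0 : 0 < bias_const.
Proof.
apply: addr_gt0; last by apply: mulr_gt0; [exact: Kp_gt0|exact: powR_gt0].
apply: mulr_gt0 => //; apply: lt_le_trans Cp_ge; apply: mulr_gt0; first exact: powR_gt0.
have : 0 < 2 / beta by rewrite divr_gt0.
by move=> /exp_rem_ge_half; apply: lt_le_trans.
Qed.

(** The left side is the rate of the walk, whose uncentred increments have norm at most [1 / beta];
    monotonicity of [exp_rem] leads to [2 / beta]. *)
Lemma le_bias_const : beta * exp_rem beta^-1 + Kp p <= bias_const.
Proof.
have q1 : 1 <= 2 `^ (p - 1) by rewrite pow2_ge1// subr_ge0 ltW.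
have bi0 : 0 < beta^-1 by rewrite invr_gt0.
rewrite /bias_const lerD//; last by rewrite ler_peMr// ltW// Kp_gt0.
rewrite ler_wpM2l ?(ltW beta0)//; apply: le_trans Cp_ge.
have H : exp_rem beta^-1 <= exp_rem (2 / beta).
  by apply: exp_rem_le; rewrite bi0 ler_peMl ?(ltW bi0)// ler1n.
apply: le_trans H _; rewrite ler_peMl//.
have : 0 < 2 / beta by rewrite divr_gt0.
by move=> /exp_rem_ge_half; apply: le_trans.
Qed.

Lemma bias_const_large : 1 <= beta -> 2 `^ p + 1 <= 2 * bias_const.
Proof.
move=> b1.
have E : 2 * 2 `^ (p - 1) = 2 `^ p :> R.
  by rewrite mulr_powRB1// (lt_trans ltr01).
have bf : 1 <= beta * exp_rem (2 / beta).
  rewrite -ler_pdivrMl// mulr1.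
  have := @exp_rem_ge_id2 R (2 / beta); rewrite divr_gt0//= ler_pdivrMr// ler_peMr//.
  by move=> /(_ isT); rewrite mulrAC divff// mul1r.
have := ler_wpM2l (ltW beta0) Cp_ge.
have := pow2_Kp_ge1 p1.
have := ler_wpM2l (powR_ge0 2 p) bf.
rewrite /bias_const -E; lra.
Qed.

(** For [b < 1] use [(2 b)^p >= 2 b] and [b^p >= b^2]; what remains is [b^2 + b >= 1], true from
    [(sqrt 5 - 1) / 2 < 5/8] on. *)
Lemma large_mean_scalar (b : R) : 5 / 8 <= b -> 1 + b <= (2 `^ p + 1) * b `^ p.
Proof.
move=> b58; have b0 : 0 < b by lra.
rewrite mulrDl mul1r -powRM ?(ltW b0)//.
have : 2 * b <= (2 * b) `^ p by apply: le1r_powR; [lra|exact: ltW].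
have [b1|b1] := leP 1 b.
  have : b <= b `^ p by apply: le1r_powR => //; exact: ltW.
  lra.
have : b ^+ 2 <= b `^ p.
  by apply: sqr_le_powR; case/andP: p12 => // _ _; rewrite !ltW.
nra.
Qed.

End constants.

(** * The anytime bound, by cases on [beta] and on the size of the mean *)

Section truncated_mean.
Context {R : realType} {B : normedModType R} {d : measure_display} {T : measurableType d}.
Variables (P : probability T R) (F : nat -> set (set T)) (X : nat -> T -> B).
Variables (mu : B) (beta p v delta lam : R).
Hypotheses (sepB : separable B) (beta0 : 0 < beta) (smooth : beta_smooth B beta).
Hypotheses (filtF : filtration F) (adaptedX : adapted F X).
Hypothesis meanX : forall n, (1 <= n)%N -> forall A, F n.-1 A ->
  forall phi : B -> R, cont_lin_functional phi ->
  (\int[P]_(w in A) (phi (X n w))%:E = (phi mu)%:E * P A)%E.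
Hypothesis momentX : forall n, (1 <= n)%N -> forall A, F n.-1 A ->
  (\int[P]_(w in A) (`|X n w| `^ p)%:E <= v%:E * P A)%E.
Hypotheses (p12 : 1 < p <= 2) (v0 : 0 < v) (delta01 : 0 < delta <= 1) (lam0 : 0 < lam).

Let p1 : 1 < p. Proof. by case/andP: p12. Qed.
Let delta0 : 0 < delta. Proof. by case/andP: delta01. Qed.
Let sF n : sigma_algebra setT (F n). Proof. by case: filtF. Qed.
Let Fm n : F n `<=` measurable. Proof. by case: filtF => _ []. Qed.
Let Fle n m : (n <= m)%N -> F n `<=` F m. Proof. by case: filtF => _ [_]; apply. Qed.

Let log_ge0 : 0 <= ln (2 / delta).
Proof.
by apply: ln_ge0; rewrite ler_pdivlMr// mul1r; case/andP: delta01; lra.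
Qed.

Definition trunc_sum n w : B := \sum_(1 <= m < n.+1) truncate lam (X m w).

Let trunc_sumS n w : trunc_sum n.+1 w = trunc_sum n w + truncate lam (X n.+1 w).
Proof. by rewrite /trunc_sum big_nat_recr. Qed.

Lemma borel_trunc_sum n : borel_wrt (F n) (trunc_sum n).
Proof.
elim: n => [|n IH].
  rewrite (_ : trunc_sum 0 = cst 0); first exact: borel_wrt_cst.
  by apply/funext => w; rewrite /trunc_sum big_geq.
rewrite (_ : trunc_sum n.+1 = trunc_sum n \+ (truncate lam \o X n.+1)); last first.
  by apply/funext => w; rewrite trunc_sumS.
apply: borel_wrtD => //; first by move=> U /IH; exact: Fle.
by apply: borel_wrt_comp; [exact: truncate_continuous|exact: adaptedX].
Qed.

Lemma borel_mu_hat_dist n : borel_wrt measurable (fun w => `|mu_hat X lam n w - mu|).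
Proof.
have -> : (fun w => `|mu_hat X lam n w - mu|) =
    (fun x : B => `|n%:R^-1 *: x - mu|) \o trunc_sum n by [].
apply: borel_wrt_comp; last by move=> U /(borel_trunc_sum n) /Fm.
move=> x; apply: (@continuous_comp _ _ _ (fun x : B => n%:R^-1 *: x - mu) (fun z => `|z|)).
  by apply: cvgB; [apply: cvgZr; exact: cvg_id|exact: cvg_cst].
exact: norm_continuous.
Qed.

(** The scale [lam / beta] brings each truncated term to norm at most [1 / beta]. *)
Definition walk n w : B := (lam / beta) *: (trunc_sum n w - n%:R *: mu).

Lemma borel_walk n : borel_wrt (F n) (walk n).
Proof.
have -> : walk n = (fun x : B => (lam / beta) *: (x - n%:R *: mu)) \o trunc_sum n by [].
apply: borel_wrt_comp (borel_trunc_sum n) => x.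
by apply: cvgZr; apply: cvgB; [exact: cvg_id|exact: cvg_cst].
Qed.

Let walkS n w :
  walk n.+1 w = walk n w + (lam / beta) *: (truncate lam (X n.+1 w) - mu).
Proof.
rewrite /walk trunc_sumS -scalerDr -natr1 scalerDl scale1r.
by rewrite opprD addrACA.
Qed.

Lemma norm_walk n w : (1 <= n)%N ->
  `|mu_hat X lam n w - mu| = beta / (lam * n%:R) * `|walk n w|.
Proof.
move=> n1; have n0 : 0 < n%:R :> R by rewrite ltr0n.
have -> : mu_hat X lam n w - mu = n%:R^-1 *: (trunc_sum n w - n%:R *: mu).
  by rewrite scalerBr scalerA mulVf ?gt_eqF// scale1r.
rewrite /walk 2!normrZ (gtr0_norm (divr_gt0 lam0 beta0)) gtr0_norm ?invr_gt0//.
by rewrite mulrA; congr (_ * _); field; rewrite !gt_eqF.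
Qed.

Let bound n := 2 * v * lam `^ (p - 1) * bias_const B beta p
  + beta * ln (2 / delta) / (lam * n%:R).

Let bound_ge n : 0 <= beta * ln (2 / delta) / (lam * n%:R).
Proof. by apply: divr_ge0; apply: mulr_ge0 => //; exact: ltW. Qed.

Let good := [set w | forall n : nat, (1 <= n)%N -> `|mu_hat X lam n w - mu| <= bound n].

Let measurable_good : measurable good.
Proof.
pose C n := if (1 <= n)%N then [set w | `|mu_hat X lam n w - mu| <= bound n] else setT.
have -> : good = \bigcap_n C n.
  apply/seteqP; split => w H n => [_|n1]; last by have := H n I; rewrite /C n1.
  by rewrite /C; case: ifP => // n1; exact: H.
apply: bigcapT_measurable => n; rewrite /C; case: ifP => // _.
apply: borel_wrt_le; first exact: sigma_algebra_measurable.
exact: borel_mu_hat_dist.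
Qed.

Let good_setT : good = setT -> ((1 - delta)%:E <= P good)%E.
Proof. by move=> ->; rewrite probability_setT lee_fin gerBl ltW. Qed.

Let lam_powE : lam * lam `^ (p - 1) = lam `^ p.
Proof. by rewrite mulr_powRB1 ?(ltW lam0)// (lt_trans ltr01). Qed.

Let main_bound_ge0 : 0 <= 2 * v * lam `^ (p - 1) * bias_const B beta p.
Proof.
apply: mulr_ge0; last exact: ltW (bias_const_gt0 _ beta0 p12).
by apply: mulr_ge0 (powR_ge0 _ _); apply: mulr_ge0 => //; exact: ltW.
Qed.

Lemma good_degenerate : beta < 1 -> good = setT.
Proof.
move=> b1; apply/seteqP; split => // w _ n n1.
rewrite (beta_smooth_lt1_norm0 smooth) ?beta0//.
by rewrite addr_ge0.
Qed.

Lemma good_large_mean : 1 <= beta -> 5 / 8 <= lam * `|mu| -> good = setT.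
Proof.
move=> b1 mularge; apply/seteqP; split => // w _ n n1.
have n0 : 0 < n%:R :> R by rewrite ltr0n.
have muv : `|mu| `^ p <= v.
  apply: (@norm_mean_powR_le _ _ _ P _ (F 0) (X 1) _ _ _ _ _ _ _ _ _ beta) => //.
  - by move=> U oU; apply: (@Fm 1); exact: adaptedX.
  - exact: (meanX (ltnSn 0)).
  - exact: (momentX (ltnSn 0)).
  - exact: ltW.
rewrite /bound -(ler_pM2l lam0).
(* Every truncated term has norm at most [1 / lam], hence so has their average. *)
apply: (@le_trans _ _ (1 + lam * `|mu|)).
  apply: (@le_trans _ _ (lam * (`|mu_hat X lam n w| + `|mu|))).
    by rewrite ler_wpM2l ?(ltW lam0)// ler_normB.
  rewrite mulrDr lerD2r /mu_hat -/(trunc_sum n w) normrZ gtr0_norm ?invr_gt0//.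
  rewrite mulrCA ler_pdivrMl// mulr1.
  apply: (@le_trans _ _ (lam * \sum_(1 <= m < n.+1) `|truncate lam (X m w)|)).
    by rewrite ler_wpM2l ?(ltW lam0)// ler_norm_sum.
  rewrite mulr_sumr; apply: (@le_trans _ _ (\sum_(1 <= m < n.+1) 1)).
    by apply: ler_sum => m _; exact: norm_truncate_le1.
  by rewrite big_const_nat iter_addr addr0 subn1.
rewrite mulrDr -[leLHS]addr0 lerD//; last by rewrite mulr_ge0 ?(ltW lam0).
apply: le_trans (large_mean_scalar p12 mularge) _.
rewrite powRM ?(ltW lam0)//.
have -> : lam * (2 * v * lam `^ (p - 1) * bias_const B beta p) =
  2 * bias_const B beta p * (lam `^ p * v) by rewrite -lam_powE; ring.
apply: ler_pM; [by rewrite addr_ge0 ?powR_ge0|by rewrite mulr_ge0 ?powR_ge0| |].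
- exact: bias_const_large.
- by rewrite ler_wpM2l ?powR_ge0.
Qed.

Lemma good_small_mean : 1 <= beta -> lam * `|mu| <= 5 / 8 ->
  ((1 - delta)%:E <= P good)%E.
Proof.
move=> b1 musmall.
(* The growth rate per step from [integral_coshR_truncated_step]; multiplied by [beta / lam] it
   becomes the bias term. *)
pose rho := 2 * (Kp p / beta + exp_rem beta^-1) * lam `^ p * v.
have bi0 : 0 < beta^-1 by rewrite invr_gt0.
have rho0 : 0 <= rho.
  rewrite /rho; apply: mulr_ge0 (ltW v0); apply: mulr_ge0 (powR_ge0 _ _).
  apply: mulr_ge0 => //; apply: addr_ge0.
    by apply: mulr_ge0; rewrite ltW// Kp_gt0.
  exact: le_trans (exp_rem_ge_half bi0).
have rho_le : beta / lam * rho <= 2 * v * lam `^ (p - 1) * bias_const B beta p.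
  have -> : beta / lam * rho =
      2 * v * lam `^ (p - 1) * (beta * exp_rem beta^-1 + Kp p).
    by rewrite /rho -lam_powE; field; rewrite !gt_eqF.
  apply: ler_wpM2l; last exact: le_bias_const.
  by apply: mulr_ge0 (powR_ge0 _ _); apply: mulr_ge0 => //; exact: ltW.
have k0 : 0 < 1 + rho by rewrite ltr_pwDl.
apply: (@le_trans _ _
  (P [set w | forall n, (coshR `|walk n w| <= (1 + rho) ^+ n / delta)%R])).
  apply: (ville_geometric filtF k0 delta01).
  - by move=> n w; rewrite ltW// coshR_gt0.
  - move=> w; rewrite /walk /trunc_sum big_geq// scale0r subrr scaler0 normr0.
    exact: coshR0.
  - by move=> n; exact: (borel_wrt_comp coshR_norm_continuous (@borel_walk n)).
  - move=> n A FA; under eq_integral do rewrite walkS.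
    have mX : borel_wrt measurable (X n.+1).
      by move=> U oU; apply: (@Fm n.+1); exact: adaptedX.
    apply: (integral_coshR_adapted_step sepB (@sF n) (@Fm n)) => //.
    + exact: borel_walk.
    + apply: (@borel_wrt_comp _ _ _ _ (fun x => (lam / beta) *: (truncate lam x - mu))) mX => x.
      apply: cvgZr; apply: cvgB; last exact: cvg_cst.
      exact: truncate_continuous.
    + move=> s A' FA'; apply: (integral_coshR_truncated_step (@sF n) (@Fm n) mX) => //.
      * exact: (meanX (ltn0Sn n)).
      * exact: (momentX (ltn0Sn n)).
      * by case/andP: p12.
      * exact: expR_le2.
apply: le_measure; rewrite ?inE//.
  rewrite (_ : [set _ | _] = \bigcap_n [set w | coshR `|walk n w| <= (1 + rho) ^+ n / delta]).
    apply: bigcapT_measurable => n; apply: borel_wrt_le; first exact: sigma_algebra_measurable.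
    apply: (borel_wrt_comp coshR_norm_continuous).
    by move=> U /(borel_walk n) /Fm.
  by apply/seteqP; split => w H n; [move=> _; exact: H|exact: (H n I)].
move=> w H n n1; have n0 : 0 < n%:R :> R by rewrite ltr0n.
(* The [2] in the logarithm comes from [e^x <= 2 cosh x], and [(1 + rho)^n <= e^(n rho)] makes the
   growth linear. *)
have walk_le : `|walk n w| <= n%:R * rho + ln (2 / delta).
  rewrite -ler_expR expRD lnK ?posrE ?divr_gt0//.
  apply: le_trans (expR_le_2coshR _) _.
  apply: le_trans (ler_wpM2l _ (H n)) _ => //.
  rewrite mulrCA ler_wpM2r ?divr_ge0 ?(ltW delta0)//.
  rewrite expRM_natl lerXn2r ?nnegrE ?expR_ge0 ?(ltW k0)//.
  exact: expR_ge1Dx.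
rewrite norm_walk//.
have bl0 : 0 <= beta / (lam * n%:R).
  by apply: divr_ge0; [exact: ltW|apply: mulr_ge0 => //; exact: ltW].
apply: le_trans (ler_wpM2l bl0 walk_le) _.
rewrite /bound.
have -> : beta / (lam * n%:R) * (n%:R * rho + ln (2 / delta)) =
  beta / lam * rho + beta * ln (2 / delta) / (lam * n%:R).
  by field; rewrite !gt_eqF.
by rewrite lerD2r.
Qed.

Lemma truncated_mean_anytime : ((1 - delta)%:E <= P good)%E.
Proof.
have [b1|b1] := leP 1 beta; last exact/good_setT/good_degenerate.
have [mularge|/ltW musmall] := leP (5 / 8) (lam * `|mu|).
  exact/good_setT/good_large_mean.
exact: good_small_mean.
Qed.

Lemma truncated_mean_fixed_size n (b : R) : (1 <= n)%N -> bound n <= b ->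
  ((1 - delta)%:E <= P [set w | (`|mu_hat X lam n w - mu| <= b)%R])%E.
Proof.
move=> n1 nb; apply: le_trans truncated_mean_anytime _.
apply: le_measure; rewrite ?inE//; last by move=> w /(_ n n1) /le_trans; apply.
apply: borel_wrt_le; first exact: sigma_algebra_measurable.
exact: borel_mu_hat_dist.
Qed.

End truncated_mean.

(** This [lam] solves [lam^p = Q / C], which makes the two summands equal; hence the factor [2]. *)
Lemma optimal_scale {R : realType} (Q C p : R) : 0 < Q -> 0 < C -> 1 < p ->
  let lam := (Q / C) `^ p^-1 in
  lam `^ (p - 1) * C + Q / lam = 2 * C `^ p^-1 * Q `^ ((p - 1) / p).
Proof.
move=> Q0 C0 p1 lam; have p0 : 0 < p := lt_trans ltr01 p1.
have QC0 : 0 < Q / C by rewrite divr_gt0.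
have lam0 : 0 < lam by rewrite powR_gt0.
have lamp : lam `^ p = Q / C.
  by rewrite /lam -powRrM mulVf ?gt_eqF// powRr1// ltW.
have E1 : lam `^ (p - 1) * C = Q / lam.
  apply: (mulfI (lt0r_neq0 lam0)); rewrite mulrA mulr_powRB1 ?(ltW lam0)// lamp.
  by field; rewrite !gt_eqF.
have E2 : Q / lam = C `^ p^-1 * Q `^ ((p - 1) / p).
  apply: (mulIf (lt0r_neq0 lam0)); rewrite divfK ?gt_eqF//.
  rewrite /lam powRM ?invr_ge0 ?(ltW Q0) ?(ltW C0)//.
  rewrite [Q `^ p^-1 * _]mulrC mulrACA.
  rewrite -powRM ?invr_ge0 ?(ltW C0)// divff ?gt_eqF// powR1 mul1r.
  rewrite -powRD; last by rewrite (gt_eqF Q0) implybT.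
  rewrite (_ : (p - 1) / p + p^-1 = 1) ?powRr1 ?(ltW Q0)//.
  by field; rewrite gt_eqF.
rewrite E1 E2; ring.
Qed.

Unset Implicit Arguments.

Theorem theorem3 (R : realType) (B : completeNormedModType R) (beta : R)
  (d : measure_display) (T : measurableType d) (P : probability T R)
  (F : nat -> set (set T)) (X : nat -> T -> B) (mu : B) (p v delta : R) :
  separable B -> 0 < beta -> beta_smooth B beta ->
  filtration F -> adapted F X ->
  (* E(X_n | F_{n-1}) = mu, via the defining property of conditional expectation
     tested against all continuous linear functionals *)
  (forall n, (1 <= n)%N -> forall A, F n.-1 A ->
     forall phi : B -> R, cont_lin_functional phi ->
       (\int[P]_(w in A) (phi (X n w))%:E = (phi mu)%:E * P A)%E) ->
  (* E(|X_n|^p | F_{n-1}) <= v, via the defining property *)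
  (forall n, (1 <= n)%N -> forall A, F n.-1 A ->
     (\int[P]_(w in A) (`|X n w| `^ p)%:E <= v%:E * P A)%E) ->
  1 < p <= 2 -> 0 < v -> 0 < delta <= 1 ->
  (forall lam : R, 0 < lam ->
     (P [set w | forall n : nat, (1 <= n)%N ->
        (`|mu_hat X lam n w - mu| <=
          2 * v * lam `^ (p - 1) * (beta * Cp B beta p + Kp p * 2 `^ (p - 1))
          + beta * ln (2 / delta) / (lam * n%:R))%R] >= (1 - delta)%:E)%E)
  /\
  (forall n : nat, (1 <= n)%N ->
     let lam := (ln (2 / delta) * beta /
                  (2 * n%:R * v * (beta * Cp B beta p + Kp p * 2 `^ (p - 1)))) `^ p^-1 in
     (P [set w | (`|mu_hat X lam n w - mu| <=
         2 * (2 * v * (beta * Cp B beta p + Kp p * 2 `^ (p - 1))) `^ p^-1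
           * (beta * ln (2 / delta) / n%:R) `^ ((p - 1) / p))%R] >= (1 - delta)%:E)%E).
Proof.
move=> sepB beta0 smooth filtF adaptedX meanX momentX p12 v0 delta01.
split=> [lam lam0|n n1].
  exact: (truncated_mean_anytime sepB beta0 smooth filtF adaptedX meanX momentX).
cbv zeta; set lam := (ln (2 / delta) * beta / _) `^ _.
have [p1 _] := andP p12; have [delta0 delta1] := andP delta01.
have n0 : 0 < n%:R :> R by rewrite ltr0n.
(* Strict positivity, from [delta <= 1 < 2], makes the prescribed [lam] positive. *)
have L0 : 0 < ln (2 / delta) by apply: ln_gt0; rewrite ltr_pdivlMr// mul1r; lra.
have c0 := bias_const_gt0 B beta0 p12.
pose Q := beta * ln (2 / delta) / n%:R; pose C := 2 * v * bias_const B beta p.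
have Q0 : 0 < Q by apply: divr_gt0 => //; exact: mulr_gt0.
have C0 : 0 < C by apply: mulr_gt0 => //; exact: mulr_gt0.
have lamE : lam = (Q / C) `^ p^-1.
  rewrite /lam -/(bias_const B beta p); congr (_ `^ _).
  by rewrite /Q /C; field; rewrite !gt_eqF.
have lam0 : 0 < lam by rewrite lamE powR_gt0// divr_gt0.
apply: (truncated_mean_fixed_size sepB beta0 smooth filtF adaptedX meanX momentX) => //.
rewrite -[X in _ <= X](optimal_scale Q0 C0 p1) -lamE.
rewrite le_eqVlt; apply/orP; left; apply/eqP; congr (_ + _).
  by rewrite /C; ring.
by rewrite /Q; field; rewrite !gt_eqF.
Qed.
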